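(* (i) There is $n_0$ such that for all $n\ge n_0$ Maker has a winning strategy in the game $\mathcal{D}_2(2:b)$ on $K_n$ with $b=\frac{1}{9}\,n^{1/8}/(\ln n)^{3/8}$. (ii) For every $\epsilon>0$ there is $n_1=n_1(\epsilon)$ such that for all $n\ge n_1$ Breaker has a winning strategy in the game $\mathcal{D}_2(2:b)$ on $K_n$ with $b=(2+\epsilon)\sqrt{n/\ln n}$.
   Context: For positive integers $a,b,d$, the $d$-diameter game $\mathcal{D}_d(a:b)$ is the following two-player, perfect-information game on the edge set of the complete graph $K_n$ on $n$ vertices. Maker and Breaker alternately claim previously unclaimed edges, Maker moving first. In each of his turns Maker claims $a$ unclaimed edges, and in each of his turns Breaker claims $b$ unclaimed edges (a player claims all remaining edges if fewer remain than he should claim). The game ends when all edges of $K_n$ are claimed. Maker wins if and only if the graph on the $n$ vertices of $K_n$ formed by Maker's edges has diameter at most $d$ (a disconnected graph has infinite diameter); otherwise Breaker wins. When the expression given for $b$ is not an integer, it is to be read as its integer part $\lfloor b\rfloor$. $\ln$ denotes the natural logarithm. *)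

(* Defs.v *)
From HB Require Import structures.
From mathcomp Require Import all_boot all_order all_algebra.
From mathcomp Require Import all_classical all_reals all_analysis.

Set Implicit Arguments.
Unset Strict Implicit.
Unset Printing Implicit Defensive.

Import Order.TTheory GRing.Theory Num.Theory.

Local Open Scope ring_scope.

(* A graph on the vertex set 'I_n is given by its edge set, whose elements are
   2-subsets of 'I_n. *)
Definition complete_edges (n : nat) : {set {set 'I_n}} :=
  [set e : {set 'I_n} | #|e| == 2%N].

Definition adjacent (n : nat) (G : {set {set 'I_n}}) : rel 'I_n :=
  fun u v => (u != v) && ([set u; v]%SET \in G).

(* Least length of a walk from u to v; it is +oo when there is none, since
   ereal_inf set0 = +oo. *)
Definition graph_dist (R : realType) (n : nat) (G : {set {set 'I_n}})
    (u v : 'I_n) : \bar R :=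
  ereal_inf [set l | exists p : seq 'I_n,
    [/\ path (adjacent G) u p, last u p = v & l = ((size p)%:R)%:E]]%classic.

Definition diameter (R : realType) (n : nat) (G : {set {set 'I_n}}) : \bar R :=
  ereal_sup [set l | exists u v : 'I_n, l = graph_dist R G u v]%classic.

Inductive player := Maker | Breaker.

(* The list of the moves made so far, in chronological order; the moves at
   even positions (starting from 0) are Maker's. *)
Definition history (n : nat) := seq {set {set 'I_n}}.

Definition mover (i : nat) : player := if odd i then Breaker else Maker.

Definition maker_graph (n : nat) (h : history n) : {set {set 'I_n}} :=
  (\bigcup_(i < size h | ~~ odd i) nth finset.set0 h i)%SET.

Definition unclaimed (n : nat) (h : history n) : {set {set 'I_n}} :=
  (complete_edges n :\: \bigcup_(X <- h) X)%SET.

Definition game_over (n : nat) (h : history n) : bool :=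
  unclaimed h == finset.set0.

Definition quota (a b : nat) (p : player) : nat :=
  match p with Maker => a | Breaker => b end.

Definition legal_move (a b n : nat) (h : history n) (X : {set {set 'I_n}}) :
    bool :=
  [&& ~~ game_over h, X \subset unclaimed h
    & #|X| == minn (quota a b (mover (size h))) #|unclaimed h|].

Definition legal_play (a b n : nat) (h : history n) : Prop :=
  forall i, (i < size h)%N -> legal_move a b (take i h) (nth finset.set0 h i).

Definition strategy (n : nat) := history n -> {set {set 'I_n}}.

Definition follows (n : nat) (p : player) (s : strategy n) (h : history n) :
    Prop :=
  forall i, (i < size h)%N -> mover i = p -> nth finset.set0 h i = s (take i h).

Definition wins (R : realType) (d n : nat) (p : player) (h : history n) :
    Prop :=
  match p with
  | Maker => (diameter R (maker_graph h) <= (d%:R)%:E)%E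
  | Breaker => ~ (diameter R (maker_graph h) <= (d%:R)%:E)%E
  end.

Definition winning_strategy (R : realType) (d a b n : nat) (p : player)
    (s : strategy n) : Prop :=
  forall h : history n, legal_play a b h -> follows p s h ->
    (~~ game_over h -> mover (size h) = p -> legal_move a b h (s h)) /\
    (game_over h -> wins R d p h).

Definition has_winning_strategy (R : realType) (d a b n : nat) (p : player) :
    Prop :=
  exists s : strategy n, winning_strategy R d a b p s.

(* Main.v *)
Require Import Defs.
From HB Require Import structures.
From mathcomp Require Import all_boot all_order all_algebra.
From mathcomp Require Import all_classical all_reals all_analysis.
From mathcomp Require Import fintype finset zify ring lra.

Import Order.TTheory GRing.Theory Num.Theory.

Local Open Scope ring_scope.

Set Implicit Arguments.
Unset Strict Implicit.
Unset Printing Implicit Defensive.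

(** Both halves rest on an invariant of positions (Maker's edges, Breaker's
    edges) that the strategist can restore in each of his turns, that the other
    player cannot destroy, and that is only compatible with a final position
    the strategist wins ([strategy_of_invariant]).

    Maker.  His first edge of each turn collects, for every vertex u, a set
    [nbr u] of D of his neighbours of u, with D of order b ln n.  His second
    edge then keeps Breaker from owning, for a pair (u, v), all edges wv with w
    in [nbr u]: one Maker edge among them joins u to v by the path u, w, v.
    This second task is a biased Erdos-Selfridge-Beck game.  A pair that is not
    joined yet gets the weight lam^(number of Breaker edges among its wv), where
    lam = 1 + 1/(2(b+1)) is so close to 1 that the b edges of one Breaker turn
    add less than what Maker removes with the heaviest free edge.  A lost pair
    would have weight lam^D, and D is chosen so that the n^2 initial weights sum
    up to less than that.

    The difficulty is that the sets [nbr u] grow during the game, and the edge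
    wv may belong to Breaker when w enters [nbr u].  Averaged over the possible
    w, this costs little as long as v has a small Breaker degree, and a factor g
    per missing neighbour, with g slightly above 1, pays for it
    ([pair_potential_extend]).  The Breaker degree is small at the vertices
    whose set is not complete, because Maker extends the set of the vertex of
    largest weight mu^(Breaker degree) / 2^(size of its set): this is a second
    potential argument ([degree_potential_Breaker], [advance]).  Once the set of
    v is complete the degree of v is out of control, but then the pair can be
    watched from v instead of u; this is why pairs are ordered and some of them
    are dropped ([prune]).  The argument works for b up to a constant times
    sqrt n / ln n, well above the bias needed.

    Breaker.  He first takes all free edges at one vertex u, which costs about
    n/b turns and leaves Maker at most about 2n/b neighbours of u.  Every vertex
    v that Maker has not touched is then a box: the edges from v to Maker's
    neighbours of u.  If Breaker empties a box, u and v are at distance more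
    than 2.  Maker spoils at most two boxes per turn, and Breaker digs evenly in
    the surviving ones, so that a Maker turn followed by a Breaker turn, with N
    boxes before and N' after it, changes the average content by about
    - (b - 2) / N'.  Summing up, the average drops by about (b/2) ln n in total,
    and this exceeds the initial content 2n/b as soon as b^2 > 4 n / ln n
    ([budget_remove], [dig]). *)

(** * From invariants to strategies *)

Local Notation edges n := {set {set 'I_n}}.

Definition opponent (p : player) : player :=
  if p is Maker then Breaker else Maker.

Definition position (n : nat) := (edges n * edges n)%type.

Definition free (n : nat) (s : position n) : edges n :=
  complete_edges n :\: (s.1 :|: s.2).

Definition claim (n : nat) (p : player) (s : position n) (X : edges n) :
    position n :=
  if p is Maker then (s.1 :|: X, s.2) else (s.1, s.2 :|: X).

Definition claimable (a b n : nat) (p : player) (s : position n)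
    (X : edges n) : bool :=
  (X \subset free s) && (#|X| == minn (quota a b p) #|free s|).

Definition breaker_graph (n : nat) (h : history n) : edges n :=
  \bigcup_(i < size h | odd i) nth set0 h i.

Definition position_of (n : nat) (h : history n) : position n :=
  (maker_graph h, breaker_graph h).

Lemma mover_next k : mover k.+1 = opponent (mover k).
Proof. by rewrite /mover /=; case: odd. Qed.

Lemma opponentK p : opponent (opponent p) = p.
Proof. by case: p. Qed.

Lemma position_of_nil n : position_of ([::] : history n) = (set0, set0).
Proof. by rewrite /position_of /maker_graph /breaker_graph !big_ord0. Qed.

Lemma position_of_rcons n (h : history n) X :
  position_of (rcons h X) = claim (mover (size h)) (position_of h) X.
Proof.
have step (P : pred nat) :
    (\bigcup_(i < size (rcons h X) | P i) nth set0 (rcons h X) i)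
    = ((\bigcup_(i < size h | P i) nth set0 h i)
       :|: (if P (size h) then X else set0)).
  rewrite size_rcons big_mkcond big_ord_recr /= nth_rcons ltnn eqxx.
  congr (_ :|: _); rewrite [RHS]big_mkcond.
  by apply: eq_bigr => i _; rewrite nth_rcons ltn_ord.
rewrite /position_of /maker_graph /breaker_graph.
rewrite (step (fun i => ~~ odd i)) (step (fun i => odd i)) /mover.
by case: (odd (size h)) => /=; rewrite setU0.
Qed.

Lemma unclaimed_free n (h : history n) : unclaimed h = free (position_of h).
Proof.
rewrite /unclaimed /free; congr (_ :\: _).
elim/last_ind: h => [|h X IH]; first by rewrite position_of_nil big_nil setU0.
rewrite position_of_rcons -cats1 big_cat /= big_seq1 IH.
by rewrite /claim; case: mover => /=; [rewrite setUAC | rewrite setUA].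
Qed.

Definition valid (n : nat) (s : position n) : bool :=
  [disjoint s.1 & s.2] && (s.1 :|: s.2 \subset complete_edges n).

Lemma claim_valid n p (s : position n) (X : edges n) :
  valid s -> X \subset free s -> valid (claim p s X).
Proof.
move=> /andP [d12 sub]; rewrite subsetD => /andP [Xc].
rewrite -setI_eq0 setIUr setU_eq0 !setI_eq0 => /andP [X1 X2].
rewrite /valid; case: p => /=.
  rewrite setUAC subUset sub Xc andbT -setI_eq0 setIUl setU_eq0 !setI_eq0.
  by rewrite d12 X2.
rewrite setUA subUset sub Xc andbT -setI_eq0 setIUr setU_eq0 !setI_eq0.
by rewrite d12 (disjoint_sym s.1 X) X1.
Qed.

(** The invariant is a property of the position and of the player about to move,
    so that a strategy can recover from the position alone whatever auxiliary
    data its correctness needs: such data is hidden under an existential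
    quantifier of the invariant. *)
Section Invariant.

Variables (R : realType) (d a b n : nat) (p : player).
Variable Q : player -> position n -> Prop.

Hypothesis Q_start : Q Maker (set0, set0).
Hypothesis Q_own : forall s : position n, valid s -> free s != set0 ->
  Q p s -> exists2 X, claimable a b p s X & Q (opponent p) (claim p s X).
Hypothesis Q_other : forall (s : position n) X, valid s -> free s != set0 ->
  Q (opponent p) s -> claimable a b (opponent p) s X ->
  Q p (claim (opponent p) s X).
Hypothesis Q_end : forall q (s : position n), valid s -> free s = set0 ->
  Q q s ->
  match p return Prop with
  | Maker => (diameter R s.1 <= d%:R%:E)%E
  | Breaker => ~ (diameter R s.1 <= d%:R%:E)%E
  end.

(* The moves of the strategy are picked among those that restore the invariant;
   the set0 returned elsewhere is never played. *)
Let good (h : history n) : Prop :=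
  valid (position_of h) /\ Q (mover (size h)) (position_of h).

Let step (h : history n) (X : edges n) : Prop :=
  legal_move a b h X /\ good (rcons h X).

Let play (h : history n) : edges n :=
  match pselect (exists X, step h X) with
  | left e => projT1 (cid e)
  | right _ => set0
  end.

Let legal_claimable (h : history n) (X : edges n) :
  legal_move a b h X
  = (free (position_of h) != set0)
    && claimable a b (mover (size h)) (position_of h) X.
Proof. by rewrite /legal_move /game_over !unclaimed_free. Qed.

Let good_rcons (h : history n) (X : edges n) : good h -> legal_move a b h X ->
  Q (mover (size (rcons h X))) (position_of (rcons h X)) -> good (rcons h X).
Proof.
move=> [dis _]; rewrite legal_claimable => /and3P [_ sX _] HQ; split=> //.
by rewrite position_of_rcons; apply: claim_valid.
Qed.

Let play_step (h : history n) :
  good h -> ~~ game_over h -> mover (size h) = p ->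
  step h (play h).
Proof.
move=> [dis HQ] ov mv; rewrite /play; case: pselect => [e|].
  by case: (cid e).
case; have fr : free (position_of h) != set0.
  by rewrite -unclaimed_free.
rewrite mv in HQ; have [X cX QX] := Q_own dis fr HQ.
have lX : legal_move a b h X by rewrite legal_claimable fr mv.
exists X; split=> //; apply: good_rcons => //.
  by split=> //; rewrite mv.
by rewrite size_rcons mover_next position_of_rcons mv.
Qed.

Lemma strategy_of_invariant : has_winning_strategy R d a b n p.
Proof.
exists play => h leg fol.
have gh : good h.
  elim/last_ind: h leg fol => [|h X IH] leg fol.
    rewrite /good position_of_nil; split=> //.
    by rewrite /valid setU0 sub0set -setI_eq0 set0I eqxx.
  have leg' : legal_play a b h.
    move=> i ih; have := leg i; rewrite size_rcons => /(_ (ltnW ih)).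
    by rewrite nth_rcons ih -cats1 takel_cat // ltnW.
  have fol' : follows p play h.
    move=> i ih mi; have := fol i; rewrite size_rcons => /(_ (ltnW ih) mi).
    by rewrite nth_rcons ih -cats1 takel_cat // ltnW.
  have gh := IH leg' fol'.
  have lX : legal_move a b h X.
    have := leg (size h); rewrite size_rcons => /(_ (ltnSn _)).
    by rewrite nth_rcons ltnn eqxx -cats1 take_size_cat.
  have ov : ~~ game_over h by case/and3P: lX.
  case: (pselect (mover (size h) = p)) => [mv|mv].
    have := fol (size h); rewrite size_rcons => /(_ (ltnSn _) mv).
    rewrite nth_rcons ltnn eqxx -cats1 take_size_cat // cats1 => ->.
    by case: (play_step gh ov mv).
  have mo : mover (size h) = opponent p.
    by move: mv; case: (mover _); case: (p).
  apply: good_rcons => //; rewrite size_rcons mover_next position_of_rcons mo.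
  rewrite opponentK; case: gh => dis; rewrite mo => HQ.
  move: lX; rewrite legal_claimable mo => /andP [fr cX].
  exact: Q_other.
split=> [ov mv|]; first by case: (play_step gh ov mv).
rewrite /game_over unclaimed_free => /eqP fr.
by case: gh => dis HQ; have := Q_end dis fr HQ; case: (p).
Qed.

End Invariant.

(** * Diameter at most two *)

(** The case u = v is the walk of length 0. *)
Definition joined (n : nat) (G : edges n) (u v : 'I_n) : bool :=
  [|| u == v, [set u; v] \in G
    | [exists w, ([set u; w] \in G) && ([set w; v] \in G)]].

Lemma complete_edge n (u v : 'I_n) :
  ([set u; v] \in complete_edges n) = (u != v).
Proof. by rewrite inE cards2; case: (u == v). Qed.

Lemma diameter2_joined (R : realType) n (G : edges n) :
  G \subset complete_edges n -> (forall u v, joined G u v) ->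
  (diameter R G <= (2%:R)%:E)%E.
Proof.
move=> /subsetP sG allj.
have adjE x y : [set x; y] \in G -> Defs.adjacent G x y.
  by move=> xy; rewrite /Defs.adjacent xy andbT -complete_edge; apply: sG.
apply: ge_ereal_sup => _ [u [v ->]].
suff [p [pp lp sp]] : exists p : seq 'I_n,
    [/\ path (Defs.adjacent G) u p, last u p = v & (size p <= 2)%N].
  apply: ereal_inf_le; exists ((size p)%:R)%:E; first by exists p.
  by rewrite lee_fin ler_nat.
case/or3P: (allj u v) => [/eqP ->|uv|/existsP [w /andP [uw wv]]].
- by exists [::].
- by exists [:: v]; split=> //=; rewrite adjE.
- by exists [:: w; v]; split=> //=; rewrite !adjE.
Qed.

Lemma diameter2_not_joined (R : realType) n (G : edges n) u v :
  ~~ joined G u v -> ~ (diameter R G <= (2%:R)%:E)%E.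
Proof.
move=> nj dle.
have : (graph_dist R G u v <= (2%:R)%:E)%E.
  by apply: le_trans dle; apply: ereal_sup_ubound; exists u, v.
apply/negP; rewrite -ltNge.
apply: (@lt_le_trans _ _ ((3%:R)%:E)); first by rewrite lte_fin ltr_nat.
apply: le_ereal_inf_tmp => _ [p [pp lp ->]]; rewrite lee_fin ler_nat ltnNge.
apply: contra nj => sp; rewrite /joined.
case: p pp lp sp => [|x [|y [|z p]]] //=.
- by move=> _ ->; rewrite eqxx.
- by rewrite andbT => /andP [_ ux] <- _; rewrite ux orbT.
- move=> /and3P [/andP [_ ux] /andP [_ xy] _] <- _.
  by apply/or3P; apply: Or33; apply/existsP; exists x; rewrite ux.
Qed.

(** * Elementary inequalities *)

(** A converse to Bernoulli's inequality for small j x; it turns the powers of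
    lam and mu into linear functions of the number of edges Breaker claims. *)
Lemma exprD1_le (R : realFieldType) (x : R) (j : nat) :
  0 <= x -> 2 * j%:R * x <= 1 -> (1 + x) ^+ j <= 1 + 2 * j%:R * x.
Proof.
move=> x0; elim: j => [|j IH]; first by rewrite expr0; lra.
rewrite -natr1 => jx; have j0 : 0 <= j%:R :> R by [].
have jx1 : 2 * j%:R * x <= 1 by nra.
have := IH jx1; rewrite exprSr => /(ler_wpM2r (addr_ge0 ler01 x0)).
by move/le_trans; apply; nra.
Qed.

Lemma ex_le_average (R : realFieldType) (T : finType) (W : {set T})
    (h : T -> R) (c : R) :
  W != set0 -> \sum_(w in W) h w <= c * #|W|%:R ->
  exists2 w, w \in W & h w <= c.
Proof.
move=> /set0Pn [w0 w0W] le_sum.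
case: (pickP [pred w in W | h w <= c]) => [w /andP [wW hw]|none].
  by exists w.
have big w : w \in W -> c < h w.
  by move=> wW; have := none w; rewrite /= wW /= ltNge => ->.
have : \sum_(w in W) c < \sum_(w in W) h w.
  rewrite (bigD1 w0) //= [ltRHS](bigD1 w0) //=.
  by apply: ltr_leD; [exact: big | apply: ler_sum => w /andP [/big /ltW]].
by rewrite sumr_const -mulr_natr ltNge le_sum.
Qed.

Lemma ler_sum_subpred (R : numDomainType) (I : finType) (P Q : pred I)
    (F : I -> R) :
  (forall i, P i -> Q i) -> (forall i, 0 <= F i) ->
  \sum_(i | P i) F i <= \sum_(i | Q i) F i.
Proof.
move=> PQ F0; rewrite big_mkcond [leRHS]big_mkcond; apply: ler_sum => i _.
by case: ifP => [/PQ ->|_] //; case: ifP.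
Qed.

Lemma set2_injl (T : finType) (v : T) : injective (fun w => [set w; v]).
Proof.
move=> x y exy.
have : x \in [set y; v] by rewrite -exy set21.
rewrite !inE => /orP [/eqP //|/eqP xv].
have : y \in [set x; v] by rewrite exy set21.
by rewrite !inE xv orbb => /eqP ->.
Qed.

(** * Maker's potentials *)

(** In this part D is the number of neighbours Maker collects at each vertex,
    Delta bounds the Breaker degree of the vertices that still lack some, and g
    is the factor per missing neighbour that pays for the Breaker edges met when
    a neighbour is added.  Using b + 1 instead of b gives the strict inequality
    needed at the end of Breaker's turns, and covers b = 0. *)
Section MakerStrategy.

Variables (R : realType) (n b D Delta : nat) (g : R).

Let beta : R := b.+1%:R.
Let lam : R := 1 + (2 * beta)^-1.
Let mu : R := 1 + (8 * beta)^-1.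

Hypothesis g_ge1 : 1 <= g.

Implicit Types (M B Y : edges n) (nbr : 'I_n -> {set 'I_n})
  (T : {set 'I_n * 'I_n}) (u v w : 'I_n) (e : {set 'I_n}) (p : 'I_n * 'I_n).

(** The edges wv for w in the set collected at u, where p = (u, v). *)
Definition threat nbr p : edges n := [set [set w; p.2] | w in nbr p.1].

(** The set T holds the ordered pairs that are still watched. *)
Definition live M T p : bool := (p \in T) && ~~ joined M p.1 p.2.

(** This is lam^D times the usual weight lam^-(number of edges of the threat
    that Breaker still lacks): neighbours of u yet to be chosen count as lacking,
    and a pair lost for Maker has weight at least lam^D. *)
Definition pair_weight B nbr p : R :=
  g ^+ (D - #|nbr p.1|) * lam ^+ #|threat nbr p :&: B|.

Definition pair_potential M B nbr T : R :=
  \sum_(p | live M T p) pair_weight B nbr p.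

Definition edge_weight M B nbr T e : R :=
  \sum_(p | live M T p && (e \in threat nbr p)) pair_weight B nbr p.

Let beta_gt0 : 0 < beta. Proof. by rewrite ltr0n. Qed.
Let lam_gt1 : 1 < lam. Proof. by rewrite ltrDl invr_gt0 mulr_gt0. Qed.
Let mu_gt1 : 1 < mu. Proof. by rewrite ltrDl invr_gt0 mulr_gt0. Qed.
Let lam_gt0 : 0 < lam. Proof. exact: lt_trans lam_gt1. Qed.
Let mu_gt0 : 0 < mu. Proof. exact: lt_trans mu_gt1. Qed.
Let g_gt0 : 0 < g. Proof. exact: lt_le_trans g_ge1. Qed.

Lemma pair_weight_ge0 B nbr p : 0 <= pair_weight B nbr p.
Proof. by rewrite mulr_ge0 // exprn_ge0 // ltW. Qed.

Lemma joined_mono M M' u v : M \subset M' -> joined M u v -> joined M' u v.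
Proof.
move=> /subsetP sM /or3P [uv|/sM uv|/existsP [w /andP [/sM uw /sM wv]]].
- by rewrite /joined uv.
- by rewrite /joined uv orbT.
by apply/or3P/Or33/existsP; exists w; rewrite uw.
Qed.

Lemma live_mono M M' T p : M \subset M' -> live M' T p -> live M T p.
Proof.
move=> sM /andP [pT nj]; rewrite /live pT /=.
by apply: contra nj; apply: joined_mono.
Qed.

Lemma pair_potential_mono M M' B nbr T : M \subset M' ->
  pair_potential M' B nbr T <= pair_potential M B nbr T.
Proof.
move=> sM; apply: ler_sum_subpred => p; first exact: live_mono.
exact: pair_weight_ge0.
Qed.

Lemma edge_weight_mono M M' B nbr T e : M \subset M' ->
  edge_weight M' B nbr T e <= edge_weight M B nbr T e.
Proof.
move=> sM; apply: ler_sum_subpred => p; last exact: pair_weight_ge0.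
by move=> /andP [/(live_mono sM) -> ->].
Qed.

(** The pairs threatened through e become joined, hence leave the sum. *)
Lemma pair_potential_Maker M M' B nbr T e :
  (forall u w, w \in nbr u -> [set u; w] \in M) -> M \subset M' -> e \in M' ->
  pair_potential M' B nbr T + edge_weight M B nbr T e
    <= pair_potential M B nbr T.
Proof.
move=> anch sM eM'.
rewrite [leRHS](bigID (fun p => e \in threat nbr p)) /= [leRHS]addrC lerD2r.
apply: ler_sum_subpred => p; last exact: pair_weight_ge0.
move=> lp; rewrite (live_mono sM lp) /=; apply/negP => /imsetP [w wN ew].
case/andP: lp => _ /negP; apply; apply/or3P/Or33/existsP; exists w.
by rewrite -ew eM' andbT (subsetP sM) // anch.
Qed.

Let lam_pow j : (j <= b)%N -> lam ^+ j <= 1 + j%:R / beta.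
Proof.
move=> jb; have -> : j%:R / beta = 2 * j%:R * (2 * beta)^-1 :> R.
  by field; rewrite gt_eqF.
apply: exprD1_le; first by rewrite invr_ge0 mulr_ge0 // ltW.
rewrite ler_pdivrMr ?mulr_gt0 // mul1r ler_pM2l // ler_nat; lia.
Qed.

Let mu_pow j : (j <= b)%N -> mu ^+ j <= 1 + j%:R / (4 * beta).
Proof.
move=> jb; have -> : j%:R / (4 * beta) = 2 * j%:R * (8 * beta)^-1 :> R.
  by field; rewrite gt_eqF.
apply: exprD1_le; first by rewrite invr_ge0 mulr_ge0 // ltW.
rewrite ler_pdivrMr ?mulr_gt0 // mul1r.
have : j%:R <= beta by rewrite ler_nat; lia.
have : 0 <= j%:R :> R by [].
by have := beta_gt0; lra.
Qed.

Lemma card_setI_sum (A : edges n) Y :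
  #|A :&: Y|%:R = \sum_(e in Y) (e \in A)%:R :> R.
Proof.
rewrite -sum1_card natr_sum big_mkcond [RHS]big_mkcond.
by apply: eq_bigr => e _; rewrite inE; case: (e \in A); case: (e \in Y).
Qed.

(** Beck's estimate: as lam^j is at most 1 + j / (b + 1) for j <= b, the
    interaction between the edges claimed in one turn is under control and the
    edges can be accounted for one by one. *)
Lemma pair_potential_Breaker M B Y nbr T : (#|Y| <= b)%N ->
  pair_potential M (B :|: Y) nbr T
    <= pair_potential M B nbr T
       + beta^-1 * \sum_(e in Y) edge_weight M B nbr T e.
Proof.
move=> Yb; rewrite /edge_weight.
under [X in _ * X]eq_bigr => e _ do rewrite big_mkcondr.
rewrite exchange_big mulr_sumr -big_split; apply: ler_sum => p _ /=.
have -> : \sum_(e in Y) (if e \in threat nbr p then pair_weight B nbr p else 0)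
    = pair_weight B nbr p * #|threat nbr p :&: Y|%:R.
  rewrite card_setI_sum mulr_sumr; apply: eq_bigr => e _.
  by case: ifP; rewrite ?mulr1 ?mulr0.
set j := #|threat nbr p :&: Y|.
have jb : (j <= b)%N by apply: leq_trans Yb; rewrite subset_leq_card ?subsetIr.
have w0 := pair_weight_ge0 B nbr p.
apply: (@le_trans _ _ (pair_weight B nbr p * lam ^+ j)).
  rewrite /pair_weight -mulrA -exprD ler_pM2l ?exprn_gt0 //.
  by rewrite ler_weXn2l ?ltW // setIUr (leq_trans (leq_card_setU _ _)).
apply: (le_trans (ler_wpM2l w0 (lam_pow jb))).
by rewrite mulrDr mulr1 lerD2l mulrA [leRHS]mulrC.
Qed.

Definition breaker_degree B v : nat := #|[set e in B | v \in e]|.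

(** Only the vertices that lack neighbours are in danger of attracting many
    Breaker edges.  The factor 2 per missing neighbour is what Maker divides the
    weight by when he serves the vertex. *)
Definition vertex_weight B nbr v : R :=
  if (#|nbr v| < D)%N then mu ^+ breaker_degree B v * 2 ^+ (D - #|nbr v|)
  else 0.

Definition degree_potential B nbr : R := \sum_v vertex_weight B nbr v.

Lemma vertex_weight_ge0 B nbr v : 0 <= vertex_weight B nbr v.
Proof.
rewrite /vertex_weight; case: ifP => // _.
by rewrite mulr_ge0 ?exprn_ge0 // ltW.
Qed.

(** Each of the at most b edges raises two degrees, and each of these 2b
    increments adds at most m / (4 (b + 1)). *)
Lemma degree_potential_Breaker B Y nbr m :
  Y \subset complete_edges n -> (#|Y| <= b)%N ->
  0 <= m -> (forall v, vertex_weight B nbr v <= m) ->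
  degree_potential (B :|: Y) nbr <= degree_potential B nbr + m / 2.
Proof.
move=> Yc Yb m0 weight_m.
have step v : vertex_weight (B :|: Y) nbr v
    <= vertex_weight B nbr v
       + (4 * beta)^-1 * \sum_(e in Y) (v \in e)%:R * vertex_weight B nbr v.
  rewrite /vertex_weight; case: ifP => _; last first.
    by rewrite big1 ?mulr0 ?addr0 // => *; rewrite mulr0.
  set j := breaker_degree Y v; set c := 2 ^+ _.
  have c0 : 0 <= c by rewrite exprn_ge0.
  have -> : \sum_(e in Y) (v \in e)%:R * (mu ^+ breaker_degree B v * c)
      = j%:R * (mu ^+ breaker_degree B v * c).
    rewrite -mulr_suml; congr (_ * _).
    rewrite /j /breaker_degree -sum1_card natr_sum.
    rewrite big_mkcond [RHS]big_mkcond; apply: eq_bigr => e _; rewrite inE.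
    by case: (e \in Y); case: (v \in e).
  have jb : (j <= b)%N.
    apply: leq_trans Yb; apply/subset_leq_card/subsetP => e.
    by rewrite inE => /andP [].
  have le1 : mu ^+ breaker_degree (B :|: Y) v
      <= mu ^+ breaker_degree B v * mu ^+ j.
    rewrite -exprD ler_weXn2l ?ltW // (leq_trans _ (leq_card_setU _ _)) //.
    by apply: subset_leq_card; apply/subsetP => e; rewrite !inE andb_orl.
  have mu_ge0 := exprn_ge0 (breaker_degree B v) (ltW mu_gt0).
  have le2 := ler_wpM2l mu_ge0 (mu_pow jb).
  have expand (x y z t : R) : x * (1 + y * z) * t = x * t + z * (y * (x * t)).
    by ring.
  by rewrite -expand; exact: (ler_wpM2r c0 (le_trans le1 le2)).
apply: (le_trans (ler_sum _ (fun v _ => step v))).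
rewrite big_split lerD2l /= -mulr_sumr exchange_big /=.
have two : \sum_(e in Y) \sum_v (v \in e)%:R * vertex_weight B nbr v
    <= beta * (2 * m).
  apply: (@le_trans _ _ (\sum_(e in Y) 2 * m)); last first.
    rewrite sumr_const -[leLHS]mulr_natl; apply: ler_wpM2r.
      by rewrite mulr_ge0.
    by rewrite ler_nat ltnW.
  apply: ler_sum => e eY.
  have /eqP e2 : #|e| == 2%N by have := subsetP Yc e eY; rewrite inE.
  apply: (@le_trans _ _ (\sum_(v in e) m)); last first.
    by rewrite sumr_const e2 mulr_natl.
  rewrite [leRHS]big_mkcond; apply: ler_sum => v _.
  by case: (v \in e); rewrite ?mul1r ?mul0r.
apply: (@le_trans _ _ ((4 * beta)^-1 * (beta * (2 * m)))).
  by rewrite ler_wpM2l // invr_ge0 mulr_ge0 // ltW.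
by rewrite le_eqVlt; apply/orP; left; apply/eqP; field; rewrite gt_eqF.
Qed.

(** The third and fourth clauses say that a pair with two incomplete ends is
    watched from both sides, and that no pair is watched from an incomplete
    vertex towards a complete one, whose Breaker degree is not bounded.  The
    last clause is what the final position needs: each pair is watched from at
    least one side. *)
Definition sound M nbr T : Prop :=
  [/\ forall u w, w \in nbr u -> [set u; w] \in M,
      forall u, (#|nbr u| <= D)%N,
      forall u v, u != v -> (#|nbr u| < D)%N -> (#|nbr v| < D)%N ->
        (u, v) \in T,
      forall u v, (u, v) \in T -> (#|nbr u| < D)%N -> (#|nbr v| < D)%N
    & forall u v, u != v -> ((u, v) \in T) || ((v, u) \in T)].

Definition add_nbr nbr u w : 'I_n -> {set 'I_n} :=
  fun x => if x == u then w |: nbr x else nbr x.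

Definition prune nbr T :=
  [set p in T | (#|nbr p.1| < D)%N ==> (#|nbr p.2| < D)%N].

Lemma card_add_nbr nbr u w x : w \notin nbr u ->
  #|add_nbr nbr u w x| = ((x == u) + #|nbr x|)%N.
Proof.
by move=> wN; rewrite /add_nbr; case: eqP => [->|//]; rewrite cardsU1 wN.
Qed.

(** If u becomes complete, the pairs (x, u) with x incomplete are dropped, but
    before that both ends were incomplete, so (u, x) is still watched. *)
Lemma sound_add M nbr T u w : sound M nbr T -> w \notin nbr u ->
  (#|nbr u| < D)%N ->
  sound ([set u; w] |: M) (add_nbr nbr u w) (prune (add_nbr nbr u w) T).
Proof.
move=> [anch kD both inc cover] wN uD; set nbr' := add_nbr nbr u w.
have kE x : #|nbr' x| = ((x == u) + #|nbr x|)%N by rewrite card_add_nbr.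
have mono x : (#|nbr' x| < D)%N -> (#|nbr x| < D)%N.
  by rewrite kE; apply: leq_ltn_trans (leq_addl _ _).
split.
- move=> x y; rewrite /nbr' /add_nbr; case: eqP => [->|_ /anch xy].
    by rewrite !inE => /orP [/eqP ->|/anch ->]; rewrite ?eqxx ?orbT.
  by rewrite !inE xy orbT.
- by move=> x; rewrite kE; case: eqP => [->//|_]; apply: kD.
- move=> x y xy xD yD; rewrite inE /= yD implybT andbT.
  by apply: both; rewrite ?mono.
- by move=> x y; rewrite inE => /andP [_ /implyP].
have half x y : x != y -> (x, y) \in T ->
    ((x, y) \in prune nbr' T) || ((y, x) \in prune nbr' T).
  move=> xy xyT; rewrite !inE xyT /=.
  case: (ltnP #|nbr' x| D) => xD //=; case: (ltnP #|nbr' y| D) => yD //=.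
  have xD' := mono _ xD.
  by rewrite (both y x) 1?eq_sym // (inc _ _ xyT).
move=> x y xy; case/orP: (cover _ _ xy) => [/half-> //|/half].
by rewrite orbC; apply; rewrite eq_sym.
Qed.

Lemma card_neighbors_le B y :
  (#|[set w | [set w; y] \in B]| <= breaker_degree B y)%N.
Proof.
rewrite -(card_imset _ (@set2_injl _ y)); apply/subset_leq_card/subsetP => e.
by move=> /imsetP [w]; rewrite !inE => wB ->; rewrite wB !inE eqxx orbT.
Qed.

(* room and slack say that the at least n - (Delta + D + 1) possible new
   neighbours are so many that the average loss is covered by one factor g *)
Hypothesis room : (Delta + D + 1 < n)%N.
Hypothesis slack :
  Delta%:R <= 2 * beta * (g - 1) * (n - (Delta + D + 1))%:R.

(** Summed over all candidates w, the Breaker edges wv met at the watched v are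
    at most Delta per v, since these v are incomplete; hence some w meets at
    most the average, and raises the sum over the pairs (u, v) by a factor g at
    most.  That factor is gained back because u misses one neighbour less. *)
Lemma pair_potential_extend M B nbr T u : sound M nbr T -> (#|nbr u| < D)%N ->
  (forall v, (#|nbr v| < D)%N -> (breaker_degree B v <= Delta)%N) ->
  exists w, [/\ w \notin nbr u, w != u, [set u; w] \notin B
    & pair_potential M B (add_nbr nbr u w) (prune (add_nbr nbr u w) T)
        <= pair_potential M B nbr T].
Proof.
move=> [_ _ _ inc _] uD degD.
(* w is excluded if it is u, already collected, or taken by Breaker *)
set bad := u |: (nbr u :|: [set w | [set w; u] \in B]).
have bad_card : (#|bad| <= Delta + D + 1)%N.
  rewrite cardsU1 addnC; apply: leq_add; last by case: (_ \notin _).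
  rewrite (leq_trans (leq_card_setU _ _)) // addnC leq_add ?(ltnW uD) //.
  by rewrite (leq_trans (card_neighbors_le _ _)) ?degD.
set W := ~: bad.
have W_card : (n - (Delta + D + 1) <= #|W|)%N.
  by rewrite cardsCs setCK card_ord leq_sub2l.
have W_pos : W != set0 by rewrite -card_gt0 (leq_trans _ W_card) ?subn_gt0.
pose at_u p := live M T p && (p.1 == u).
set Pu := \sum_(p | at_u p) pair_weight B nbr p.
have Pu0 : 0 <= Pu by apply: sumr_ge0 => p _; apply: pair_weight_ge0.
pose h w := \sum_(p | at_u p) pair_weight B nbr p * ([set w; p.2] \in B)%:R.
have [w wW hw] : exists2 w, w \in W & h w <= 2 * beta * (g - 1) * Pu.
  apply: ex_le_average => //; rewrite /h exchange_big /=.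
  apply: (@le_trans _ _ (Delta%:R * Pu)).
    rewrite /Pu mulr_sumr; apply: ler_sum => p /andP [/andP [pT _] /eqP pu].
    rewrite -mulr_sumr mulrC ler_wpM2r ?pair_weight_ge0 //.
    have p2D : (#|nbr p.2| < D)%N.
      by apply: (inc p.1); rewrite -?surjective_pairing // pu.
    rewrite -natr_sum ler_nat (leq_trans _ (degD _ p2D)) //.
    rewrite (leq_trans _ (card_neighbors_le _ _)) // -sum1_card.
    rewrite big_mkcond [leqRHS]big_mkcond; apply: leq_sum => w _.
    by rewrite inE; case: (w \in W); case: (_ \in B).
  have W_le : (n - (Delta + D + 1))%:R <= #|W|%:R :> R by rewrite ler_nat.
  have c0 : 0 <= 2 * beta * (g - 1).
    by rewrite !mulr_ge0 ?subr_ge0 // ltW.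
  have := ler_wpM2r Pu0 (le_trans slack (ler_wpM2l c0 W_le)).
  by rewrite -!mulrA [#|W|%:R * _]mulrC.
move: wW; rewrite !inE !negb_or [[set w; u]]setUC => /and3P [wu wN wB].
exists w; split=> //; set nbr' := add_nbr nbr u w.
have kE x : #|nbr' x| = ((x == u) + #|nbr x|)%N by rewrite card_add_nbr.
apply: (@le_trans _ _ (\sum_(p | live M T p) pair_weight B nbr' p)).
  apply: ler_sum_subpred => p; last exact: pair_weight_ge0.
  by rewrite /live inE => /andP [/andP [-> _] ->].
rewrite /pair_potential (bigID (fun p => p.1 == u)) /=.
rewrite [leRHS](bigID (fun p => p.1 == u)) /=.
apply: lerD; last first.
  rewrite le_eqVlt; apply/orP; left; apply/eqP; apply: eq_bigr => p.
  move=> /andP [_ /negbTE pu].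
  by rewrite /pair_weight kE pu /threat /nbr' /add_nbr pu.
have step p : p.1 = u -> pair_weight B nbr' p
    <= g^-1 * (pair_weight B nbr p
       + (lam - 1) * (pair_weight B nbr p * ([set w; p.2] \in B)%:R)).
  move=> pu; rewrite ler_pdivlMl // /pair_weight kE pu eqxx.
  rewrite add1n -(subnSK uD) exprS -!mulrA.
  rewrite [X in _ <= _ + X]mulrCA -mulrDr ler_pM2l //.
  rewrite [X in _ <= _ + X]mulrCA -mulrDr ler_pM2l ?exprn_gt0 //.
  have -> : threat nbr' p = [set w; p.2] |: threat nbr p.
    by rewrite /threat /nbr' /add_nbr pu eqxx imsetU1.
  rewrite setIUl; have card_le := leq_card_setU ([set [set w; p.2]] :&: B)
    (threat nbr p :&: B).
  apply: (@le_trans _ _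
    (lam ^+ (([set w; p.2] \in B) + #|threat nbr p :&: B|))).
    rewrite ler_weXn2l ?ltW // (leq_trans card_le) // leq_add2r.
    case: (boolP (_ \in B)) => wB'; last first.
      by rewrite leqn0 cards_eq0 setI_eq0 disjoints1.
    by rewrite (leq_trans (subset_leq_card (subsetIl _ _))) // cards1.
  case: (_ \in B); last by rewrite mulr0 mulr0 addr0.
  by rewrite mulr1 add1n exprS mulrBl mul1r addrC subrK.
apply: (@le_trans _ _ (\sum_(p | at_u p) g^-1 * (pair_weight B nbr p
   + (lam - 1) * (pair_weight B nbr p * ([set w; p.2] \in B)%:R)))).
  by apply: ler_sum => p /andP [_ /eqP]; apply: step.
rewrite -mulr_sumr big_split -mulr_sumr -/Pu -/(h w) ler_pdivrMl //.
have lam1 : (lam - 1) * (2 * beta) = 1.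
  by rewrite /lam addrC addKr mulVf // gt_eqF ?mulr_gt0.
have lam1_ge0 : 0 <= lam - 1 by rewrite subr_ge0 ltW.
have := ler_wpM2l lam1_ge0 hw.
rewrite -[_ * (g - 1) * Pu]mulrA [leRHS]mulrA lam1 mul1r.
by rewrite -lerBrDl -[X in _ <= _ - X]mul1r -mulrBl.
Qed.

Hypothesis deg_bound :
  forall d, mu ^+ d <= n%:R * 2 ^+ D -> (d <= Delta)%N.

(** The part of Maker's invariant that does not depend on whose turn it is. *)
Definition settled M B nbr T : Prop :=
  [/\ sound M nbr T, pair_potential M B nbr T < lam ^+ D
    & degree_potential B nbr <= n%:R * 2 ^+ D].

Lemma breaker_degree_le B nbr v :
  degree_potential B nbr <= n%:R * 2 ^+ D -> (#|nbr v| < D)%N ->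
  (breaker_degree B v <= Delta)%N.
Proof.
move=> le vD; apply: deg_bound; apply: le_trans le.
apply: (@le_trans _ _ (vertex_weight B nbr v)).
  rewrite /vertex_weight vD ler_peMr ?exprn_ege1 ?ler1n //.
  by rewrite exprn_ge0 // ltW.
rewrite /degree_potential (bigD1 v) //= lerDl sumr_ge0 // => x _.
exact: vertex_weight_ge0.
Qed.

Lemma settled_mono M M' B nbr T : M \subset M' -> settled M B nbr T ->
  settled M' B nbr T.
Proof.
move=> sM [[anch h1 h2 h3 h4] lt le]; split=> //.
  by split=> // u w /anch; apply: (subsetP sM).
exact: le_lt_trans (pair_potential_mono _ _ _ sM) lt.
Qed.

(** Serving the vertex of largest weight halves this weight, and the part gained
    bounds half of every other weight: this is the reserve that Breaker's next
    turn may use up. *)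
Lemma advance M B nbr T u0 : settled M B nbr T -> (#|nbr u0| < D)%N ->
  exists u w nbr' T',
    [/\ u != w /\ [set u; w] \notin B,
        settled ([set u; w] |: M) B nbr' T',
        forall v, degree_potential B nbr' + vertex_weight B nbr' v / 2
          <= n%:R * 2 ^+ D
      & \sum_x #|nbr' x| = (\sum_x #|nbr x|).+1].
Proof.
move=> [snd lt le] u0D.
have [u uD umax] :=
  @arg_maxP _ _ _ u0 (fun u => #|nbr u| < D)%N (vertex_weight B nbr) u0D.
have degD v : (#|nbr v| < D)%N -> (breaker_degree B v <= Delta)%N.
  exact: breaker_degree_le.
have [w [wN wu wB pair_le]] := pair_potential_extend snd uD degD.
set nbr' := add_nbr nbr u w in pair_le.
have kE x : #|nbr' x| = ((x == u) + #|nbr x|)%N by rewrite card_add_nbr.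
have weight_other x : x != u -> vertex_weight B nbr' x = vertex_weight B nbr x.
  by move=> /negbTE xu; rewrite /vertex_weight kE xu.
have weight_u : vertex_weight B nbr' u <= vertex_weight B nbr u / 2.
  rewrite {2}/vertex_weight uD /vertex_weight kE eqxx add1n.
  case: ifP => _; last by rewrite mulr_ge0 ?mulr_ge0 ?exprn_ge0 ?ltW.
  by rewrite -(subnSK uD) exprSr mulrA mulfK.
have weight_le v : vertex_weight B nbr' v <= vertex_weight B nbr u.
  have [->|vu] := eqVneq v u.
    by have := vertex_weight_ge0 B nbr u; lra.
  rewrite weight_other //; case: (ltnP #|nbr v| D) => [/umax //|vD].
  by rewrite {1}/vertex_weight ltnNge vD vertex_weight_ge0.
have degree_le : degree_potential B nbr'
    <= degree_potential B nbr - vertex_weight B nbr u / 2.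
  rewrite /degree_potential (bigD1 u) //= [X in _ <= X - _](bigD1 u) //=.
  rewrite (eq_bigr (vertex_weight B nbr)); last first.
    by move=> x; apply: weight_other.
  lra.
exists u, w, nbr', (prune nbr' T); split.
- by rewrite eq_sym.
- split; first exact: sound_add.
    apply: le_lt_trans (pair_potential_mono _ _ _ (subsetUr _ _)) _.
    exact: le_lt_trans pair_le lt.
  by have := vertex_weight_ge0 B nbr u; lra.
- by move=> v; have := weight_le v; lra.
- rewrite (eq_bigr _ (fun x _ => kE x)) big_split /= -add1n; congr (_ + _)%N.
  by rewrite (bigD1 u) //= eqxx big1 // => x /negbTE ->.
Qed.

(** When no edge is free, the candidates for a new neighbour are Maker's
    neighbours already, so the sets can be completed without claiming edges, and
    it does not matter whether Maker had the time to complete them during the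
    game. *)
Lemma complete_nbrs M B nbr T : settled M B nbr T ->
  complete_edges n \subset M :|: B ->
  exists nbr' T', settled M B nbr' T' /\ forall u, #|nbr' u| = D.
Proof.
move=> st full; have [m] := ubnP (n * D - \sum_x #|nbr x|).
elim: m nbr T st => // m IH nbr T st le_m.
have kD : forall x, (#|nbr x| <= D)%N by case: st => [[]].
case: (boolP [forall u, #|nbr u| == D]) => [/forallP allD|].
  by exists nbr, T; split=> // u; apply/eqP.
rewrite negb_forall => /existsP [u0 u0D].
have {u0D} : (#|nbr u0| < D)%N by rewrite ltn_neqAle u0D kD.
case/(advance st) => u [w [nbr' [T' [[uw wB] st' _ sumE]]]].
have eM : [set u; w] |: M = M.
  apply/setUidPr; rewrite sub1set.
  have := subsetP full [set u; w]; rewrite complete_edge uw => /(_ isT).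
  by rewrite inE (negbTE wB) orbF.
rewrite eM in st'; apply: (IH nbr' T' st').
have : (\sum_x #|nbr' x| <= n * D)%N.
  have k'D : forall x, (#|nbr' x| <= D)%N by case: st' => [[]].
  apply: (@leq_trans (\sum_(x : 'I_n) D)%N); first by apply: leq_sum.
  by rewrite sum_nat_const card_ord.
by rewrite sumE => lt_s; rewrite subnSK.
Qed.

(** A watched pair that is not joined has its D threat edges with Breaker, so it
    alone contributes lam^D. *)
Lemma settled_joined M B nbr T : settled M B nbr T ->
  complete_edges n \subset M :|: B -> (forall u, #|nbr u| = D) ->
  forall u v, joined M u v.
Proof.
move=> [[anch _ _ _ cover] lt _] full kD.
have joinedC u v : joined M u v = joined M v u.
  rewrite /joined eq_sym setUC; congr [|| _, _ | _].
  by apply: eq_existsb => w; rewrite andbC [[set w; v]]setUC [[set u; w]]setUC.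
have live_absurd u v : (u, v) \in T -> ~~ joined M u v -> False.
  move=> uvT nj; have := nj.
  rewrite /joined !negb_or => /and3P [uv uvM no_path].
  have sB : threat nbr (u, v) \subset B.
    apply/subsetP => e /imsetP [w /= wN ->]; have uwM := anch _ _ wN.
    have wv : w != v by apply: contraNneq uvM => <-.
    have := subsetP full [set w; v]; rewrite complete_edge wv => /(_ isT).
    rewrite inE => /orP [wvM|//]; case/negP: no_path.
    by apply/existsP; exists w; rewrite uwM.
  move: lt; rewrite ltNge => /negP; apply.
  have lp : live M T (u, v) by rewrite /live uvT.
  apply: (@le_trans _ _ (pair_weight B nbr (u, v))).
    rewrite /pair_weight /= kD subnn expr0 mul1r.
    by rewrite (setIidPl sB) card_imset ?kD //; apply: set2_injl.
  rewrite /pair_potential (bigD1 (u, v)) //= lerDl sumr_ge0 // => p _.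
  exact: pair_weight_ge0.
move=> u v; apply/idPn => nj.
have uv : u != v by apply: contraNneq nj => ->; rewrite /joined eqxx.
case/orP: (cover _ _ uv) => [/live_absurd|/live_absurd]; first exact.
by rewrite joinedC; exact.
Qed.

(** A Maker turn: the edge e1 if it is still free, and an edge of largest weight
    among the others.  When at most two edges are free they are all claimed. *)
Lemma claim_two (U : edges n) (f : {set 'I_n} -> R) e1 : U != set0 ->
  exists X : edges n, [/\ X \subset U, #|X| = minn 2 #|U|, e1 \in U -> e1 \in X
    & forall e, e \in U -> e \notin X -> exists2 e2, e2 \in X & f e <= f e2].
Proof.
move=> /set0Pn [e' e'U]; case: (leqP #|U| 2) => [U2|U3].
  exists U; split; rewrite ?subxx //.
  by move=> e ->.
pose e0 := if e1 \in U then e1 else e'.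
have e0U : e0 \in U by rewrite /e0; case: ifP.
have /set0Pn [e3 e3U] : U :\ e0 != set0.
  by move: U3; rewrite -card_gt0 (cardsD1 e0 U) e0U add1n; case: #|_|.
have [e2 e2U max2] := @arg_maxP _ _ _ e3 [in U :\ e0] f e3U.
have {e2U} /setD1P [e20 e2U] : e2 \in U :\ e0 by [].
exists [set e0; e2]; split.
- by apply/subsetP => e /set2P [] ->.
- by rewrite cards2 eq_sym e20.
- by rewrite /e0 => ->; rewrite set21.
- move=> e eU; rewrite !inE negb_or => /andP [ee0 _]; exists e2.
    by rewrite set22.
  by apply: max2; rewrite /= !inE ee0.
Qed.

(* the potential of the empty position is at most the left-hand side *)
Hypothesis start : n%:R ^+ 2 * g ^+ D < lam ^+ D.

(* The reserves that Maker's turn leaves for the turn of Breaker. *)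
Let guard (q : player) (s : position n) nbr T : Prop :=
  q = Breaker ->
  (forall e, e \in free s ->
     pair_potential s.1 s.2 nbr T + edge_weight s.1 s.2 nbr T e < lam ^+ D)
  /\ (forall v, degree_potential s.2 nbr + vertex_weight s.2 nbr v / 2
        <= n%:R * 2 ^+ D).

Let Q (q : player) (s : position n) : Prop :=
  exists nbr T, settled s.1 s.2 nbr T /\ guard q s nbr T.

Lemma maker_start : Q Maker (set0, set0).
Proof.
exists (fun=> set0), [set p | p.1 != p.2]; split=> //; split.
- split=> [u w|u|u v|u v|u v] /=; rewrite ?inE ?cards0 //.
  by move=> ->.
- apply: le_lt_trans start.
  apply: (@le_trans _ _ (\sum_(p : 'I_n * 'I_n) g ^+ D)).
    rewrite /pair_potential big_mkcond; apply: ler_sum => p _; case: ifP => _.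
      by rewrite /pair_weight /= cards0 subn0 setI0 cards0 expr0 mulr1.
    by rewrite exprn_ge0 // ltW.
  by rewrite sumr_const card_prod card_ord -[leLHS]mulr_natl natrM expr2.
- apply: (@le_trans _ _ (\sum_(v : 'I_n) 2 ^+ D)).
    apply: ler_sum => v _; rewrite /vertex_weight cards0 subn0.
    case: ifP => _ //; rewrite /breaker_degree.
    rewrite (_ : [set e in _ | _] = set0) ?cards0 ?expr0 ?mul1r //.
    by apply/setP => e; rewrite !inE.
  by rewrite sumr_const card_ord mulr_natl.
Qed.

Lemma maker_reply (s : position n) : valid s -> free s != set0 -> Q Maker s ->
  exists2 X, claimable 2 b Maker s X & Q Breaker (claim Maker s X).
Proof.
case: s => M B /= _ fr [nbr [T [st _]]].
(* e1 may be a Maker edge already; it then costs nothing *)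
have [e1 [nbr1 [T1 [e1U st1 gd1]]]] : exists e1 nbr1 T1,
  [/\ (e1 \in M) || (e1 \in free (M, B)), settled (e1 |: M) B nbr1 T1
    & forall v, degree_potential B nbr1 + vertex_weight B nbr1 v / 2
        <= n%:R * 2 ^+ D].
  have kD : forall x, (#|nbr x| <= D)%N by case: st => [[]].
  case: (boolP [forall u, #|nbr u| == D]) => [/forallP allD|].
    have /set0Pn [e eU] := fr; exists e, nbr, T; split.
    - by rewrite eU orbT.
    - by apply: settled_mono st; apply: subsetUr.
    - move=> v; rewrite /vertex_weight (eqP (allD v)) ltnn mul0r addr0.
      by case: st.
  rewrite negb_forall => /existsP [u0 u0D].
  have {u0D} : (#|nbr u0| < D)%N by rewrite ltn_neqAle u0D kD.
  case/(advance st) => u [w [nbr' [T' [[uw wB] st' gd' _]]]].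
  exists [set u; w], nbr', T'; split=> //.
  by rewrite in_setD complete_edge uw andbT in_setU negb_or wB andbT orbN.
have [X [XU Xc e1X Xmax]] :=
  claim_two (edge_weight (e1 |: M) B nbr1 T1) e1 fr.
exists X; first by rewrite /claimable XU Xc /=.
have sub1 : e1 |: M \subset M :|: X.
  rewrite subUset subsetUl andbT sub1set inE.
  by case/orP: e1U => [->//|/e1X ->]; rewrite orbT.
exists nbr1, T1; split; first exact: settled_mono st1.
move=> _; split=> //= e eF.
have /andP [eU eX] : (e \in free (M, B)) && (e \notin X).
  by move: eF; rewrite !inE /= !negb_or -!andbA => /and4P [-> -> -> ->].
have [e2 e2X le2] := Xmax e eU eX.
case: st1 => [[anch _ _ _ _] lt1 _].
apply: le_lt_trans lt1.
apply: (le_trans _ (@pair_potential_Maker _ _ _ _ _ e2 anch sub1 _)).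
  by rewrite lerD2l (le_trans (edge_weight_mono _ _ _ _ sub1)).
by rewrite inE e2X orbT.
Qed.

Lemma maker_survives (s : position n) Y : valid s -> free s != set0 ->
  Q Breaker s -> claimable 2 b Breaker s Y -> Q Maker (claim Breaker s Y).
Proof.
case: s => M B /= _ _ [nbr [T [[snd lt le] gd]]] /andP [YU /eqP Yc].
have [gd1 gd2] := gd erefl.
have Yb : (#|Y| <= b)%N by rewrite Yc geq_minl.
have Ycomp : Y \subset complete_edges n.
  by apply: subset_trans YU (subsetDl _ _).
exists nbr, T; split=> //=; split=> //.
  apply: le_lt_trans (pair_potential_Breaker _ _ _ _ Yb) _.
  rewrite -ltrBrDl mulrC ltr_pdivrMr //.
  set gap := _ - _.
  apply: (@le_lt_trans _ _ (\sum_(e in Y) gap)).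
    by apply: ler_sum => e /(subsetP YU)/gd1; rewrite /gap; lra.
  by rewrite sumr_const -mulr_natr ltr_pM2l ?subr_gt0 // ltr_nat ltnS.
pose reserve := n%:R * 2 ^+ D - degree_potential B nbr.
apply: (le_trans
  (@degree_potential_Breaker _ _ _ (2 * reserve) _ Yb _ _)) => //.
- by rewrite mulr_ge0 // subr_ge0.
- by move=> v; have := gd2 v; rewrite /reserve /=; lra.
- by rewrite mulrC mulKf // /reserve; lra.
Qed.

Lemma maker_outcome q (s : position n) : valid s -> free s = set0 -> Q q s ->
  (diameter R s.1 <= 2%:R%:E)%E.
Proof.
case: s => M B /= /andP [_]; rewrite subUset => /andP [/= Mc _] fr.
have full : complete_edges n \subset M :|: B.
  by rewrite -setD_eq0; apply/eqP.
move=> [nbr [T [st _]]]; apply: diameter2_joined => //.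
have [nbr' [T' [st' kD]]] := complete_nbrs st full.
exact: settled_joined st' full kD.
Qed.

Lemma maker_wins : has_winning_strategy R 2 2 b n Maker.
Proof.
apply: (@strategy_of_invariant R 2 2 b n Maker Q).
- exact: maker_start.
- exact: maker_reply.
- exact: maker_survives.
- exact: maker_outcome.
Qed.

End MakerStrategy.

(** * Breaker's strategy *)

Lemma ex_subset_card (T : finType) (Y F : {set T}) (k : nat) :
  Y \subset F -> (#|Y| <= k)%N -> (k <= #|F|)%N ->
  exists Z : {set T}, [/\ Y \subset Z, Z \subset F & #|Z| = k].
Proof.
move=> YF Yk kF; elim: k Yk kF => [|k IH] Yk kF.
  by exists Y; split=> //; apply/eqP; rewrite -leqn0.
move: Yk; rewrite leq_eqVlt => /orP [/eqP Yk|]; first by exists Y.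
rewrite ltnS => /IH /(_ (ltnW kF)) [Z [YZ ZF Zk]].
have /set0Pn [x] : F :\: Z != set0.
  rewrite setD_eq0; apply: contraTN kF => /subset_leq_card.
  by rewrite Zk -leqNgt.
rewrite inE => /andP [xZ xF]; exists (x |: Z); split.
- exact: subset_trans YZ (subsetUr _ _).
- by rewrite subUset sub1set xF.
- by rewrite cardsU1 xZ Zk.
Qed.

(** The logarithm in the budget of the box game stands for the harmonic sum of
    the inverses of the numbers of boxes. *)
Lemma ln_ratio_le (R : realType) (N j : R) : 0 < j -> 0 < N ->
  N * (ln (N + j) - ln N) <= j.
Proof.
move=> j0 N0; have Nj : 0 < N + j by rewrite addr_gt0.
rewrite -ln_div ?posrE // mulrC -ler_pdivlMr //.
have -> : (N + j) / N = 1 + j / N by rewrite mulrDl divff // gt_eqF.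
by apply: le_ln1Dx; rewrite (lt_trans _ (divr_gt0 j0 N0)).
Qed.

Section BreakerStrategy.

Variables (R : realType) (n b : nat) (u : 'I_n).

Implicit Types (M B X Y Z : edges n) (A : {set 'I_n}) (c : 'I_n -> nat)
  (v w : 'I_n) (e : {set 'I_n}) (s : position n).

(** Breaker alone witnesses that u and v are not joined, so this survives all
    further moves. *)
Definition separated B v : Prop :=
  [/\ u != v, [set u; v] \in B
    & forall w, w != u -> w != v -> ([set u; w] \in B) || ([set w; v] \in B)].

Lemma separated_mono B B' v : B \subset B' -> separated B v -> separated B' v.
Proof.
move=> /subsetP sB [uv uvB sep]; split=> // [|w wu wv]; first exact: sB.
by case/orP: (sep w wu wv) => /sB ->; rewrite ?orbT.
Qed.

Lemma separated_not_joined s v : valid s -> separated s.2 v ->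
  ~~ joined s.1 u v.
Proof.
move=> /andP [dis sub] [uv uvB sep].
have MC e : e \in s.1 -> e \in complete_edges n.
  by move=> eM; apply: (subsetP sub); rewrite inE eM.
rewrite /joined !negb_or uv (disjointFl dis uvB) /=.
apply/existsP => -[w /andP [uwM wvM]].
have wu : w != u by rewrite eq_sym -complete_edge MC.
have wv : w != v by rewrite -complete_edge MC.
case/orP: (sep w wu wv) => inB; have := disjointFl dis inB.
  by rewrite uwM.
by rewrite wvM.
Qed.

(** Here u is the vertex whose edges Breaker takes first. *)
Definition open_edges s : edges n := [set e in free s | u \in e].

Definition links s v : {set 'I_n} :=
  [set w | ([set u; w] \in s.1) && ([set w; v] \in free s)].

(** The value c v only bounds the number of free edges in the box of v: it is
    lowered in a balanced way, whereas the true contents may drop faster. *)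
Definition boxes s A c : Prop :=
  [/\ u \notin A,
      forall v, v \in A -> [set u; v] \notin s.1,
      forall v w, v \in A -> [set u; w] \in s.1 -> [set w; v] \notin s.1,
      forall v, v \in A -> (#|links s v| <= c v)%N
    & forall v v', v \in A -> v' \in A -> (c v <= (c v').+1)%N].

Let kappa : R := (b%:R - 2) / 2.

(** The bound on the total content of the boxes: their number times an average
    that decreases with the number of boxes.  For b > 2 it is negative when
    between one and seven boxes are left, so Breaker must have won before. *)
Definition budget A : R := #|A|%:R * (kappa * (ln #|A|%:R - 2)).

Lemma free_claim q s X : free (claim q s X) = free s :\: X.
Proof.
apply/setP => e; case: q; rewrite /free /= !inE !negb_or;
  by case: (e \in X); case: (e \in s.1); case: (e \in s.2); rewrite ?andbF.
Qed.

Lemma box_won s A c v : valid s -> open_edges s = set0 -> boxes s A c ->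
  v \in A -> links s v = set0 -> separated s.2 v.
Proof.
move=> val star [uA AM AS _ _] vA links0.
have uv : u != v by apply: contraNneq uA => ->.
have out x y : x != y -> [set x; y] \notin free s ->
    ([set x; y] \in s.1) || ([set x; y] \in s.2).
  by move=> xy; rewrite /free in_setD complete_edge xy andbT negbK in_setU.
have starB w : w != u -> ([set u; w] \in s.1) || ([set u; w] \in s.2).
  move=> wu; apply: out; rewrite 1?eq_sym //; apply/negP => fr.
  have : [set u; w] \in open_edges s by rewrite inE fr set21.
  by rewrite star inE.
split=> //.
  have := starB v; rewrite eq_sym => /(_ uv) /orP [|//].
  by rewrite (negbTE (AM v vA)).
move=> w wu wv; case/orP: (starB w wu) => [uwM|->//]; apply/orP; right.
have : w \notin links s v by rewrite links0 inE.
rewrite inE uwM /= => /(out _ _ wv).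
by rewrite (negbTE (AS v w vA uwM)).
Qed.

Lemma boxes_claim_Breaker s A c Y : boxes s A c ->
  boxes (claim Breaker s Y) A c.
Proof.
move=> [uA AM AS Ac bal]; split=> // v vA; apply: leq_trans (Ac v vA).
apply: subset_leq_card; apply/subsetP => w.
by rewrite /links free_claim !inE => /andP [-> /andP []].
Qed.

(** One unit at a time, always from a largest value, which keeps the values
    within 1 of each other. *)
Lemma dig s A c k : boxes s A c -> A != set0 ->
  exists Y c', [/\ Y \subset free s, (#|Y| <= k)%N,
    boxes (claim Breaker s Y) A c'
    & (exists2 v, v \in A & c' v = 0%N)
      \/ (\sum_(v in A) c' v + k <= \sum_(v in A) c v)%N].
Proof.
move=> bx /set0Pn [v0 v0A]; elim: k => [|k [Y [c' [YF Yk bx' alt]]]].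
  exists set0, c; rewrite sub0set cards0 addn0; split=> //; last by right.
  exact: boxes_claim_Breaker.
case: alt => [won|sum_le].
  by exists Y, c'; split=> //; [exact: leqW | left].
have [v vA vmax] := @arg_maxnP _ v0 [in A] c' v0A.
have [c'v0|c'v_pos] := posnP (c' v).
  exists Y, c'; split=> //; first exact: leqW.
  by left; exists v.
pose c2 x := if x == v then (c' v).-1 else c' x.
have sum2 : ((\sum_(x in A) c2 x).+1 = \sum_(x in A) c' x)%N.
  rewrite (bigD1 v) //= [RHS](bigD1 v) //= {1}/c2 eqxx -addSn prednK //.
  by congr (_ + _)%N; apply: eq_bigr => x /andP [_ /negbTE xv]; rewrite /c2 xv.
have bal2 x x' : x \in A -> x' \in A -> (c2 x <= (c2 x').+1)%N.
  case: bx' => _ _ _ _ bal xA x'A; rewrite /c2.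
  case: (x == v); case: (x' == v).
  - exact: leqnSn.
  - exact: leq_trans (leq_pred _) (bal _ _ vA x'A).
  - by rewrite prednK //; apply: vmax.
  - exact: bal.
have alt2 : (\sum_(x in A) c2 x + k.+1 <= \sum_(x in A) c x)%N.
  by rewrite addnS -addSn sum2.
have [links0|[w]] := set_0Vmem (links (claim Breaker s Y) v).
  exists Y, c2; split=> //; [exact: leqW | | by right].
  case: bx' => uA AM AS Ac bal; split=> // x xA; rewrite /c2.
  by case: eqP => [->|_]; [rewrite links0 cards0 | exact: Ac].
move=> wl; have := wl; rewrite inE free_claim in_setD => /and3P [uwM wvY wvF].
have claimE : claim Breaker s ([set w; v] |: Y)
    = claim Breaker (claim Breaker s Y) [set [set w; v]].
  by rewrite /claim /= -setUA [_ |: Y]setUC.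
exists ([set w; v] |: Y), c2; split.
- by rewrite subUset sub1set wvF.
- by rewrite cardsU1 wvY.
- rewrite claimE; have := boxes_claim_Breaker [set [set w; v]] bx'.
  case=> uA AM AS Ac bal; split=> // x xA; rewrite /c2; case: eqP => [->|_].
    case: bx' => _ _ _ Ac' _; rewrite -ltnS prednK //.
    apply: leq_trans (Ac' v vA); apply: proper_card.
    apply/properP; split.
      apply/subsetP => y.
      by rewrite /links [free (claim _ (claim _ _ _) _)]free_claim !inE
        => /andP [-> /andP []].
    exists w => //; rewrite inE [free (claim _ (claim _ _ _) _)]free_claim.
    by rewrite !inE eqxx andbF.
  exact: Ac.
- by right.
Qed.

(** An edge spoils at most one box: one of its ends is a neighbour of u, and the
    vertices of A are not. *)
Lemma boxes_claim_Maker s A c X :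
  open_edges s = set0 -> boxes s A c -> X \subset free s ->
  exists K : {set 'I_n}, [/\ K \subset A, (#|K| <= #|X|)%N
    & boxes (claim Maker s X) (A :\: K) c].
Proof.
move=> star [uA AM AS Ac bal] XF.
have uX w : [set u; w] \notin X.
  apply/negP => /(subsetP XF) uwF.
  have : [set u; w] \in open_edges s by rewrite inE uwF set21.
  by rewrite star inE.
pose hit v w := ([set u; w] \in s.1) && ([set w; v] \in X).
pose K := [set v in A | [exists w, hit v w]].
have KA : K \subset A by apply/subsetP => v; rewrite inE => /andP [].
exists K; split=> //.
  pose f v := [set odflt v [pick w | hit v w]; v].
  have fP v : v \in K -> exists2 w, hit v w & f v = [set w; v].
    rewrite inE /f => /andP [_ /existsP [w hw]].
    case: pickP => [w' hw'|/(_ w)]; first by exists w'.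
    by rewrite hw.
  have inj : {in K &, injective f}.
    move=> v v' vK v'K fvv'; have vA := subsetP KA v vK.
    have [w' /andP [uw'M _] f'] := fP v' v'K.
    have : v \in f v' by rewrite -fvv' set22.
    rewrite f' => /set2P [vw'|//].
    by have := AM v vA; rewrite vw' uw'M.
  rewrite -(card_in_imset inj); apply: subset_leq_card.
  apply/subsetP => e /imsetP [v vK ->].
  by have [w /andP [_ wvX] ->] := fP v vK.
split=> [|v|v w|v|v v'].
- by rewrite inE (negbTE uA) andbF.
- by rewrite /= !inE => /andP [_ /AM /negbTE ->]; apply: uX.
- rewrite /= !inE (negbTE (uX w)) orbF => /andP [vK vA] uwM.
  rewrite (negbTE (AS v w vA uwM)) /=; apply: contra vK => wvX.
  by rewrite vA; apply/existsP; exists w; rewrite /hit uwM.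
- rewrite inE => /andP [_ vA]; apply: leq_trans (Ac v vA).
  apply/subset_leq_card/subsetP => w; rewrite /links free_claim !inE /=.
  by rewrite (negbTE (uX w)) orbF => /andP [-> /andP []].
- by rewrite !inE => /andP [_ vA] /andP [_ v'A]; apply: bal.
Qed.

Hypothesis b_gt2 : (2 < b)%N.

Let kappa_gt0 : 0 < kappa.
Proof. by rewrite divr_gt0 // subr_gt0 ltr_nat. Qed.

(** By balance a spoiled box holds at least the average content minus 1.
    Spoiling j <= 2 of N boxes thus raises the average content of the N' others
    by at most j / N', while the permitted average falls by at most
    kappa j / N'.  The total excess j (kappa + 1) is at most b. *)
Lemma budget_remove A (K : {set 'I_n}) c :
  A != set0 -> K \subset A -> (#|K| <= 2)%N ->
  (forall v v', v \in A -> v' \in A -> (c v <= (c v').+1)%N) ->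
  (\sum_(v in A) c v)%:R <= budget A ->
  A :\: K != set0 /\
  (\sum_(v in A :\: K) c v)%:R <= budget (A :\: K) + b%:R.
Proof.
move=> A0 KA K2 bal le_sum.
have A_pos : 0 < #|A|%:R :> R by rewrite ltr0n card_gt0.
have lnA : 2 <= ln (#|A|%:R : R).
  have : 0 <= budget A by apply: le_trans le_sum.
  by rewrite /budget pmulr_rge0 // pmulr_rge0 // subr_ge0.
(* a nonnegative content means that at least e^2 boxes are left *)
have A3 : (2 < #|A|)%N.
  rewrite -(ltr_nat R); apply: lt_le_trans (_ : expR 2 <= _).
    by apply: lt_le_trans (expR_ge1Dx 2); lra.
  by rewrite -[leRHS]lnK ?posrE // ler_expR.
have cardD : (#|A :\: K| + #|K| = #|A|)%N.
  by rewrite cardsD (setIidPr KA) subnK // subset_leq_card.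
have D_pos : (0 < #|A :\: K|)%N by lia.
split; first by rewrite -card_gt0.
have [K0|K_pos] := posnP #|K|.
  move/eqP: K0; rewrite cards_eq0 => /eqP ->; rewrite setD0.
  by apply: (le_trans le_sum); rewrite lerDl.
set T := (\sum_(v in A) c v)%:R in le_sum; set T' := (_)%:R.
set N := #|A|%:R in A_pos lnA.
set N' : R := #|A :\: K|%:R; set j : R := #|K|%:R.
have NE : N = N' + j by rewrite /N -cardD natrD.
have N'0 : 0 < N' by rewrite ltr0n.
have j0 : 0 < j by rewrite ltr0n.
have j2 : j <= 2 by rewrite /j (ler_nat R _ 2).
have TE : T = T' + \sum_(v in K) (c v)%:R.
  rewrite /T /T' (big_setID K) /= (setIidPr KA) addnC natrD; congr (_ + _).
  by rewrite natr_sum.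
have low v : v \in A -> T <= N * ((c v)%:R + 1).
  move=> vA; rewrite /T /N natr1 -natrM ler_nat -sum_nat_const.
  by apply: leq_sum => v' v'A; apply: bal.
have lowK : j * T <= N * (\sum_(v in K) (c v)%:R) + N * j.
  have -> : N * (\sum_(v in K) (c v)%:R) + N * j
      = \sum_(v in K) N * ((c v)%:R + 1).
    rewrite -mulr_sumr -mulrDr; congr (_ * _).
    by rewrite big_split /= sumr_const.
  rewrite /j -sum1_card natr_sum mulr_suml; apply: ler_sum => v vK.
  by rewrite mul1r low // (subsetP KA).
have ratio := ler_wpM2l (ltW kappa_gt0) (ln_ratio_le j0 N'0).
rewrite -NE in ratio.
rewrite /budget -/N in le_sum; rewrite /budget -/N'.
have main : N * T' <= N * (N' * (kappa * (ln N - 2)) + j).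
  apply: (@le_trans _ _ (N' * T + N * j)).
    by rewrite -lerBlDr -subr_ge0; move: lowK; rewrite TE NE; nra.
  rewrite mulrDr lerD2r mulrCA ler_pM2l //.
move: main; rewrite ler_pM2l // => /le_trans; apply.
have kb : 2 * (kappa + 1) = b%:R by rewrite /kappa; field.
have : kappa * j + j <= b%:R.
  rewrite -kb -{2}[j]mul1r -mulrDl mulrC ler_wpM2r // addr_ge0 // ltW //.
nra.
Qed.

(* Maker's edges by the time the star of u is full *)
Let m : nat := 2 * (n.-1 %/ b).+1.

Hypothesis m_small : (2 * m < n.-1)%N.
Hypothesis m_budget : m%:R <= kappa * (ln (n.-1 - 2 * m)%:R - 2).

(** Here k counts Breaker's turns.  Each of them takes b of the n - 1 edges at u,
    which bounds k and thereby the number of Maker's edges. *)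
Definition opening (q : player) s : Prop :=
  exists2 k, (#|s.1| <= 2 * (if q is Breaker then k.+1 else k))%N
    & (#|open_edges s| + b * k <= n.-1)%N.

(** The vertices untouched by Maker, all of whose edges to Maker's neighbours of
    u are thus free or Breaker's, become the boxes. *)
Lemma opening_boxes q s : opening q s -> open_edges s = set0 -> valid s ->
  exists A c, [/\ A != set0, boxes s A c & (\sum_(v in A) c v)%:R <= budget A].
Proof.
move=> [k Mk open_k] star val.
have Mm : (#|s.1| <= m)%N.
  apply: (leq_trans Mk); rewrite leq_mul2l /=.
  have : (k <= n.-1 %/ b)%N.
    rewrite leq_divRL; last exact: leq_trans b_gt2.
    by rewrite mulnC (leq_trans _ open_k) ?leq_addl.
  by case: (q) => //; apply: leqW.
pose S := [set w | [set u; w] \in s.1].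
have Sm : (#|S| <= m)%N.
  apply: leq_trans Mm; rewrite -(card_imset _ (@set2_injl _ u)).
  apply/subset_leq_card/subsetP => e /imsetP [w]; rewrite inE => uw ->.
  by rewrite setUC.
pose A := ~: (u |: cover s.1).
have MC e : e \in s.1 -> e \in complete_edges n.
  by case/andP: val => _ /subsetP sub eM; apply: sub; rewrite inE eM.
have cover_le : (#|cover s.1| <= 2 * m)%N.
  apply: leq_trans (leq_card_cover _) _.
  rewrite (eq_bigr (fun=> 2%N)) => [|e /MC]; last by rewrite inE => /eqP.
  by rewrite sum_nat_const mulnC leq_mul2l.
have A_card : (n.-1 - 2 * m <= #|A|)%N.
  rewrite cardsCs setCK card_ord -subn1 -subnDA leq_sub2l //.
  by rewrite cardsU1 leq_add // leq_b1.
have gap_pos : (0 < n.-1 - 2 * m)%N by rewrite subn_gt0.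
have A_pos : (0 < #|A|)%N by apply: leq_trans A_card.
have not_covered v e : v \in A -> e \in s.1 -> v \notin e.
  rewrite !inE negb_or => /andP [_ vC] eM; apply: contra vC => ve.
  by apply/bigcupP; exists e.
exists A, (fun=> #|S|); split; first by rewrite -card_gt0.
  split=> [|v vA|v w vA _|v _|//].
  - by rewrite !inE eqxx.
  - by apply/negP => /(not_covered _ _ vA); rewrite set22.
  - by apply/negP => /(not_covered _ _ vA); rewrite set22.
  - by apply/subset_leq_card/subsetP => w; rewrite !inE => /andP [].
rewrite sum_nat_const natrM /budget ler_wpM2l //.
apply: (@le_trans _ _ m%:R); first by rewrite ler_nat.
apply: (le_trans m_budget); rewrite ler_pM2l // lerD2r ler_ln ?posrE ?ltr0n //.
by rewrite ler_nat.
Qed.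

(* In Breaker's turn the b units he is about to remove are added to the
   budget. *)
Let Q (q : player) s : Prop :=
  [\/ exists v, separated s.2 v,
      open_edges s = set0 /\ exists A c,
        [/\ A != set0, boxes s A c
          & (\sum_(v in A) c v)%:R
              <= budget A + (if q is Breaker then b%:R else 0)]
    | opening q s].

Lemma open_edges_claim q s X : open_edges (claim q s X) = open_edges s :\: X.
Proof.
by apply/setP => e; rewrite /open_edges free_claim !inE -andbA.
Qed.

Lemma breaker_start : Q Maker (set0, set0).
Proof.
apply: Or33; exists 0%N; rewrite ?cards0 //= muln0 addn0.
rewrite -[n.-1](_ : #|[set~ u]| = _); last by rewrite cardsC1 card_ord.
rewrite -(card_imset _ (@set2_injl _ u)); apply/subset_leq_card/subsetP => e.
rewrite !inE => /andP [/andP [_ /cards2P [x [y [xy ->]]]] /set2P [ux|uy]].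
  by rewrite setUC; apply/imsetP; exists y; rewrite ?inE ux // eq_sym.
by apply/imsetP; exists x; rewrite ?inE uy.
Qed.

Lemma breaker_survives s X : valid s -> free s != set0 -> Q Maker s ->
  claimable 2 b Maker s X -> Q Breaker (claim Maker s X).
Proof.
move=> val _ Qs /andP [XF /eqP Xc].
have X2 : (#|X| <= 2)%N by rewrite Xc geq_minl.
case: Qs => [[v sep]|[star [A [c [A0 bx le_sum]]]]|[k Mk open_k]].
- by apply: Or31; exists v.
- apply: Or32; split; first by rewrite open_edges_claim star set0D.
  have [K [KA KX bxK]] := boxes_claim_Maker star bx XF.
  rewrite addr0 in le_sum; have [_ _ _ _ bal] := bx.
  have [D0 le_sumK] := budget_remove A0 KA (leq_trans KX X2) bal le_sum.
  by exists (A :\: K), c.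
- apply: Or33; exists k.
    rewrite mulnS addnC; apply: leq_trans (leq_card_setU _ _) _.
    exact: leq_add.
  rewrite open_edges_claim; apply: leq_trans open_k; rewrite leq_add2r.
  exact/subset_leq_card/subsetDl.
Qed.

Lemma breaker_reply s : valid s -> free s != set0 -> Q Breaker s ->
  exists2 X, claimable 2 b Breaker s X & Q Maker (claim Breaker s X).
Proof.
move=> val _ Qs; set k := minn b #|free s|.
have pad Y : Y \subset free s -> (#|Y| <= b)%N ->
    exists Z : edges n, [/\ Y \subset Z, Z \subset free s & #|Z| = k].
  move=> YF Yb; apply: ex_subset_card => //; last exact: geq_minr.
  by rewrite leq_min Yb subset_leq_card.
have ok Z : Z \subset free s -> #|Z| = k -> claimable 2 b Breaker s Z.
  by move=> ZF Zk; rewrite /claimable ZF Zk /=.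
case: Qs => [[v sep]|[star [A [c [A0 bx le_sum]]]]|[j Mj open_j]].
- have [|| Z [_ ZF Zk]] := pad set0; rewrite ?sub0set ?cards0 //.
  exists Z; first exact: ok.
  by apply: Or31; exists v; apply: separated_mono sep; apply: subsetUl.
- have [Y [c' [YF Yb bx' alt]]] := dig b bx A0.
  have [Z [YZ ZF Zk]] := pad Y YF Yb.
  exists Z; first exact: ok.
  have star' : open_edges (claim Breaker s Z) = set0.
    by rewrite open_edges_claim star set0D.
  have bxZ : boxes (claim Breaker s Z) A c'.
    have -> : claim Breaker s Z = claim Breaker (claim Breaker s Y) Z.
      by rewrite /claim /= -setUA (setUidPr YZ).
    exact: boxes_claim_Breaker.
  case: alt => [[v vA c'v]|sum_le].
    apply: Or31; exists v; apply: (box_won _ star' bxZ vA).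
      exact: claim_valid.
    apply/eqP; rewrite -cards_eq0 -leqn0 -c'v.
    by case: bxZ => _ _ _ + _; apply.
  apply: Or32; split=> //; exists A, c'; split=> //.
  rewrite addr0 -(lerD2r b%:R); apply: le_trans le_sum.
  by rewrite -natrD ler_nat.
- have [|| |Y [_ YO Yk]] := @ex_subset_card _ set0 (open_edges s)
    (minn b #|open_edges s|); rewrite ?sub0set ?cards0 ?geq_minr //.
  have YF : Y \subset free s.
    by apply: subset_trans YO _; apply/subsetP => e; rewrite inE => /andP [].
  have [|Z [YZ ZF Zk]] := pad Y YF; first by rewrite Yk geq_minl.
  exists Z; first exact: ok.
  have val' : valid (claim Breaker s Z) by apply: claim_valid.
  have le_open : (#|open_edges (claim Breaker s Z)| + #|Y|
      <= #|open_edges s|)%N.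
    rewrite open_edges_claim -(cardsID Y (open_edges s)) addnC.
    rewrite (setIidPr YO) leq_add2l.
    by apply/subset_leq_card/setDS.
  (* either the star of u is full now, or all b edges of the turn went to it *)
  have [star'|/set0Pn [e0 e0O]] := eqVneq (open_edges (claim Breaker s Z)) set0.
    have op : opening Breaker (claim Breaker s Z).
      by exists j => //; rewrite (leq_trans _ open_j) // leq_add2r
        (leq_trans _ le_open) // leq_addr.
    have [A [c [A0 bx le_sum]]] := opening_boxes op star' val'.
    by apply: Or32; split=> //; exists A, c; rewrite addr0.
  have O_pos : (0 < #|open_edges (claim Breaker s Z)|)%N.
    by apply/card_gt0P; exists e0.
  apply: Or33; exists j.+1; first exact: Mj.
  rewrite mulnS addnA (leq_trans _ open_j) // leq_add2r.
  apply: (leq_trans _ le_open); rewrite leq_add2l.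
  have : (#|Y| < #|open_edges s|)%N.
    by apply: (leq_trans _ le_open); rewrite -add1n leq_add2r.
  by rewrite Yk gtn_min ltnn orbF leq_min => /ltnW ->; rewrite leqnn.
Qed.

Lemma breaker_outcome q s : valid s -> free s = set0 -> Q q s ->
  ~ (diameter R s.1 <= 2%:R%:E)%E.
Proof.
move=> val fr Qs.
have star : open_edges s = set0.
  by apply/setP => e; rewrite [LHS]inE fr !inE.
have won A c : A != set0 -> boxes s A c -> exists v, separated s.2 v.
  move=> /set0Pn [v vA] bx; exists v; apply: (box_won val star bx vA).
  by apply/setP => w; rewrite [LHS]inE fr !inE andbF.
have [v sep] : exists v, separated s.2 v.
  case: Qs => [//|[_ [A [c [A0 bx _]]]]|op]; first exact: won A0 bx.
  have [A [c [A0 bx _]]] := opening_boxes op star val.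
  exact: won A0 bx.
exact: diameter2_not_joined (separated_not_joined val sep).
Qed.

Lemma breaker_wins : has_winning_strategy R 2 2 b n Breaker.
Proof.
apply: (@strategy_of_invariant R 2 2 b n Breaker Q).
- exact: breaker_start.
- exact: breaker_reply.
- exact: breaker_survives.
- exact: breaker_outcome.
Qed.

End BreakerStrategy.

(** * The parameters of Maker's strategy *)

(** Bernoulli's inequality, to the power k. *)
Lemma exp2_le (R : realFieldType) (m k : nat) : (0 < m)%N ->
  2 ^+ k <= (1 + m%:R^-1) ^+ (m * k) :> R.
Proof.
move=> m0; have mR : 0 < m%:R :> R by rewrite ltr0n.
have bernoulli (x : R) j : 0 <= x -> 1 + j%:R * x <= (1 + x) ^+ j.
  move=> x0; elim: j => [|j IH]; first by rewrite expr0 mul0r addr0.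
  rewrite exprS -natr1; have := ler_wpM2l (addr_ge0 ler01 x0) IH.
  apply: le_trans; have : 0 <= j%:R * x * x by rewrite !mulr_ge0.
  by move: (j%:R : R) => y; nra.
rewrite exprM; apply: lerXn2r; rewrite ?nnegrE //.
have := @bernoulli m%:R^-1 m; by rewrite mulfV ?gt_eqF // invr_ge0 ltW // => ->.
Qed.

(** The values D = 6 (b + 1) L and Delta = 8 (b + 1) (D + L) come from
    lam^(2 (b + 1)) >= 2 and mu^(8 (b + 1)) >= 2: with n < 2^L, they yield
    lam^D >= 2^(3 L) > n^3 and mu^Delta >= 2^(D + L) > n 2^D.  As at least n / 2
    neighbours are eligible at any time, g - 1 = Delta / ((b + 1) n) pays for the
    average new one, and g^D <= 2. *)
Lemma maker_wins_log (R : realType) (n b L : nat) : (1 < n)%N ->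
  (n < 2 ^ L)%N -> (672 * (b.+1 ^ 2 * L ^ 2) <= n)%N ->
  has_winning_strategy R 2 2 b n Maker.
Proof.
move=> n1 nL big.
have L0 : (0 < L)%N by case: L nL {big} => [|//]; rewrite expn0; lia.
have nR : 0 < n%:R :> R by rewrite ltr0n; lia.
pose D := (6 * b.+1 * L)%N; pose Delta := (8 * b.+1 * (D + L))%N.
pose eta : R := (8 * (D + L))%:R / n%:R.
have eta0 : 0 <= eta by rewrite divr_ge0.
pose p := (b.+1 * L)%N; have p0 : (0 < p)%N by rewrite muln_gt0.
have DE : D = (6 * p)%N by rewrite /D mulnA.
have DL : (D + L <= 7 * p)%N.
  by rewrite DE -[(7 * p)%N]/((6 + 1) * p)%N mulnDl leq_add2l mul1n leq_pmull.
have Delta_le : (Delta <= 56 * p ^ 2)%N.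
  rewrite -[(56 * _)%N]/(8 * 7 * _)%N mulnACA.
  by rewrite leq_mul // leq_mul2l leq_pmulr.
have big' : (672 * p ^ 2 <= n)%N by rewrite /p expnMn.
have room2 : (2 * (Delta + D + 1) <= n)%N.
  move: Delta_le big'; rewrite DE expnS expn1; clear -p0; nia.
have growth : (16 * (D + L) * D <= n)%N.
  apply: leq_trans big'; apply: (@leq_trans (16 * (7 * p) * (6 * p))).
    by apply: leq_mul; rewrite ?DE // leq_mul2l -DE DL.
  by clear; nia.
have nL' : n%:R < 2 ^+ L :> R by rewrite -natrX ltr_nat.
apply: (@maker_wins R n b D Delta (1 + eta)).
- by rewrite lerDl.
- by apply: leq_trans room2; lia.
- have -> : 1 + eta - 1 = eta by rewrite addrC addKr.
  rewrite /eta -!natrM mulrA mulrAC ler_pdivlMr // -!natrM ler_nat.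
  move: room2; set r := (Delta + D + 1)%N => room2.
  have half : (n <= 2 * (n - r))%N by clear -room2; lia.
  apply: (leq_trans (leq_mul (leqnn Delta) half)); apply: eq_leq.
  rewrite /Delta; move: (D + L)%N (n - r)%N => y z; clear; ring.
- move=> d; apply: contraTT; rewrite -ltnNge -ltNge => Dd.
  have mu1 : 1 <= 1 + (8 * b.+1%:R)^-1 :> R by rewrite lerDl invr_ge0 mulr_ge0.
  apply: lt_le_trans (ler_weXn2l mu1 (ltnW Dd)).
  have := @exp2_le R (8 * b.+1) (D + L) isT.
  rewrite natrM => /(lt_le_trans _); apply.
  by rewrite exprD mulrC ltr_pM2l // exprn_gt0.
- have gD : (1 + eta) ^+ D <= 2.
    have le1 : 2 * D%:R * eta <= 1.
      rewrite /eta mulrA ler_pdivrMr // mul1r -!natrM ler_nat.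
      by apply: leq_trans growth; rewrite leq_eqVlt; apply/orP; left; lia.
    by apply: le_trans (exprD1_le eta0 le1) _; lra.
  have lamD : n%:R ^+ 3 < (1 + (2 * b.+1%:R)^-1) ^+ D :> R.
    have -> : D = (2 * b.+1 * (3 * L))%N by rewrite /D; lia.
    have := @exp2_le R (2 * b.+1) (3 * L) isT.
    rewrite natrM => /(lt_le_trans _).
    by apply; rewrite [(3 * L)%N]mulnC exprM ltrXn2r // ltW.
  apply: le_lt_trans lamD; rewrite [leRHS]exprSr ler_pM2l ?exprn_gt0 //.
  by apply: (le_trans gD); rewrite (ler_nat R 2).
Qed.

(** With q = floor (log2 n / 8), both b + 1 and log2 n + 1 are O(2^q), so that
    the left-hand side is at most 2^(4 q + 18), while n >= 2^(8 q) and q >= 5. *)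
Lemma maker_large_enough (n b : nat) : (40 <= trunc_log 2 n)%N ->
  (b ^ 8 <= n)%N ->
  (672 * (b.+1 ^ 2 * (trunc_log 2 n).+1 ^ 2) <= n)%N.
Proof.
set l := trunc_log 2 n => l40 b8.
have n0 : (0 < n)%N.
  by rewrite lt0n; apply: contraTN l40 => /eqP n0; rewrite /l n0 trunc_log0.
set q := (l %/ 8)%N; have l_eq := divn_eq l 8.
have l_mod := ltn_pmod l (isT : 0 < 8)%N.
rewrite -/q in l_eq.
have q5 : (5 <= q)%N by rewrite /q leq_divRL.
have lq : (l.+1 <= 8 * q.+1)%N by lia.
have bq : (b < 2 ^ q.+1)%N.
  rewrite -(@ltn_exp2r _ _ 8) // (leq_ltn_trans b8) //.
  apply: (leq_trans (trunc_log_ltn n (isT : 1 < 2)%N)).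
  by rewrite -expnM leq_exp2l // mulnC; exact: lq.
have Lq : (l.+1 <= 2 ^ (q + 3))%N.
  apply: (leq_trans lq); rewrite expnD mulnC leq_mul2r /=.
  exact: ltn_expl.
apply: leq_trans (trunc_logP (isT : 1 < 2)%N n0); rewrite -/l.
apply: (@leq_trans (2 ^ 10 * ((2 ^ q.+1) ^ 2 * (2 ^ (q + 3)) ^ 2))).
  by rewrite leq_mul // leq_mul // leq_exp2r.
by rewrite -!expnM -!expnD leq_exp2l //; lia.
Qed.

Lemma eventually_ge (R : realType) (C : R) :
  exists n0 : nat, forall n, (n0 <= n)%N -> C <= n%:R.
Proof.
exists (Num.truncn C).+1 => n; rewrite -(ler_nat R) => /(le_trans _); apply.
exact/ltW/truncnS_gt.
Qed.

Lemma eventually_ln_ge (R : realType) (C : R) :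
  exists n0 : nat, forall n, (n0 <= n)%N -> C <= ln (n%:R : R).
Proof.
have [n0 n0P] := eventually_ge (expR C); exists n0 => n /n0P Cn.
rewrite -[leLHS]expRK ler_ln ?posrE ?expR_gt0 //.
by rewrite (lt_le_trans _ Cn) ?expR_gt0.
Qed.

Lemma maker_bias_exp8 (R : realType) (n : nat) : 1 <= ln (n%:R : R) ->
  (Num.truncn (1 / 9 * ((n%:R : R) `^ (1 / 8) / (ln (n%:R : R)) `^ (3 / 8)))
     ^ 8 <= n)%N.
Proof.
move=> l1; set x := 1 / 9 * _.
have x0 : 0 <= x by rewrite mulr_ge0 // divr_ge0 ?powR_ge0.
have l38 : 1 <= (ln (n%:R : R)) `^ (3 / 8).
  by rewrite -[leLHS](powRr0 (ln (n%:R : R))) ler_powR.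
have xle : x <= (n%:R : R) `^ (1 / 8).
  rewrite /x; have := powR_ge0 (n%:R : R) (1 / 8).
  set y := _ `^ (1 / 8) => y0.
  have : y / (ln (n%:R : R)) `^ (3 / 8) <= y.
    by rewrite ler_pdivrMr ?(lt_le_trans ltr01) // ler_peMr.
  lra.
rewrite -(ler_nat R) natrX; apply: (@le_trans _ _ (x ^+ 8)).
  by rewrite lerXn2r ?nnegrE // truncn_le.
apply: (@le_trans _ _ (((n%:R : R) `^ (1 / 8)) ^+ 8)).
  by rewrite lerXn2r ?nnegrE // powR_ge0.
by rewrite -powR_mulrn ?powR_ge0 // -powRrM mul1r mulVf // powRr1.
Qed.

Lemma maker_wins_eventually (R : realType) :
  exists n0 : nat, forall n : nat, (n0 <= n)%N ->
  has_winning_strategy R 2 2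
    (Num.truncn (1 / 9 * ((n%:R : R) `^ (1 / 8) / (ln (n%:R : R)) `^ (3 / 8))))
    n Maker.
Proof.
have [n1 n1P] := eventually_ln_ge (1 : R).
have [n2 n2P] : exists n2 : nat, forall n, (n2 <= n)%N ->
    (40 <= trunc_log 2 n)%N.
  by exists (2 ^ 40)%N => n; apply: trunc_log_max.
exists (maxn n1 n2) => n; rewrite geq_max => /andP [/n1P ln1 /n2P log40].
apply: (@maker_wins_log _ _ _ (trunc_log 2 n).+1).
- by move: log40; case: n {ln1} => [|[|n]] //; rewrite ?trunc_log0 ?trunc_log1.
- exact: trunc_log_ltn.
- exact: maker_large_enough (maker_bias_exp8 ln1).
Qed.

(** * The parameters of Breaker's strategy *)

(** This is ln n <= 2 sqrt n. *)
Lemma eventually_sqrt_ge (R : realType) (C : R) : exists n0 : nat, forall n,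
  (n0 <= n)%N -> C <= Num.sqrt (n%:R / ln (n%:R : R)).
Proof.
have [n1 n1P] := eventually_ge ((2 * C ^+ 2) ^+ 2 : R).
have [n2 n2P] := eventually_ln_ge (1 : R).
exists (maxn n1 n2) => n; rewrite geq_max => /andP [/n1P nC /n2P ln1].
set x : R := n%:R in nC ln1 *; set s := Num.sqrt x.
have l0 : 0 < ln x by apply: lt_le_trans ln1.
have x0 : 0 < x.
  by rewrite ltNge; apply/negP => x_le0; move: ln1; rewrite ln0 // ler10.
have s0 : 0 < s by rewrite sqrtr_gt0.
have sE : x = s ^+ 2 by rewrite sqr_sqrtr // ltW.
have lns : ln x <= 2 * s.
  by rewrite {1}sE lnXn // -[leLHS]mulr_natl ler_pM2l // ltW // ln_sublinear.
have Cs : 2 * C ^+ 2 <= s.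
  have C0 : 0 <= 2 * C ^+ 2 by rewrite mulr_ge0 // sqr_ge0.
  by rewrite -(ger0_norm C0) -sqrtr_sqr ler_wsqrtr.
apply: le_trans (ler_norm C) _; rewrite -sqrtr_sqr ler_wsqrtr //.
rewrite ler_pdivlMr // {2}sE expr2.
apply: (@le_trans _ _ (C ^+ 2 * (2 * s))).
  by rewrite ler_wpM2l // sqr_ge0.
by rewrite mulrCA mulrA ler_pM2r.
Qed.

(** With r = sqrt (n / ln n) and a = 2 + eps / 2, rounding b and subtracting 2
    still leaves b - 2 >= a r for large n.  The boxes start with about 2 n / b
    <= (2 / a) r ln n edges, and the budget allows about (a / 2) r ln n: the
    coefficient del = a / 2 - 2 / a of r ln n is positive because a > 2. *)
Lemma breaker_wins_eventually (R : realType) (eps : R) : 0 < eps ->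
  exists n1 : nat, forall n : nat, (n1 <= n)%N ->
    has_winning_strategy R 2 2
      (Num.truncn ((2 + eps) * Num.sqrt ((n%:R : R) / ln (n%:R : R))))
      n Breaker.
Proof.
move=> eps0; pose a := 2 + eps / 2.
have a2 : 2 < a by rewrite /a; lra.
have a0 : 0 < a by lra.
pose del := a / 2 - 2 / a.
have del0 : 0 < del.
  rewrite subr_gt0 ltr_pdivrMr // mulrAC ltr_pdivlMr //; nra.
have [n1 n1P] := eventually_ln_ge (Num.max 3 ((3 * a / 2 + 1) / del)).
have [n2 n2P] := eventually_sqrt_ge (Num.max 10 (6 / eps)).
exists (maxn n1 n2) => n; rewrite geq_max => /andP [/n1P + /n2P].
set x : R := n%:R; set l := ln x; set r := Num.sqrt (x / l).
rewrite !ge_max => /andP [l3 l_del] /andP [r10 r_eps].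
set b := Num.truncn _.
have x0 : 0 < x.
  by rewrite ltNge; apply/negP => x_le0; move: l3; rewrite /l ln0 //; lra.
have l0 : 0 < l by lra.
have xE : x = r ^+ 2 * l.
  by rewrite sqr_sqrtr ?divfK ?gt_eqF // divr_ge0 // ltW.
have b_ge : a * r + 2 <= b%:R.
  have := truncnS_gt ((2 + eps) * r); rewrite -/b -natr1.
  move: r_eps; rewrite ler_pdivrMr // /a; lra.
have b0 : 0 < b%:R :> R by nra.
have n_pos : (0 < n)%N by rewrite -(ltr0n R).
set m := (2 * (n.-1 %/ b).+1)%N.
have m_le : m%:R <= 2 * r * l / a + 2 :> R.
  rewrite /m natrM -[(n.-1 %/ b)%N.+1%:R]natr1 mulrDr mulr1 lerD2r.
  rewrite -!mulrA ler_pM2l //.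
  rewrite mulrA.
  rewrite ler_pdivlMr //.
  have div_le : (n.-1 %/ b)%:R * b%:R <= x.
    by rewrite -natrM ler_nat (leq_trans (leq_trunc_div _ _)) // leq_pred.
  have q0 : 0 <= (n.-1 %/ b)%:R :> R by [].
  have r0 : 0 < r by lra.
  have : (n.-1 %/ b)%:R * (a * r) <= r ^+ 2 * l.
    rewrite -xE; apply: le_trans div_le; apply: ler_wpM2l => //; lra.
  move=> le; rewrite -(ler_pM2r r0) -[leLHS]mulrA; apply: (le_trans le).
  by rewrite expr2 [leLHS]mulrAC.
have ra : 2 * r * l / a <= r * l.
  have rl0 : 0 < r * l by rewrite mulr_gt0 //; lra.
  by rewrite ler_pdivrMr // -mulrA mulrC ler_pM2l // ltW.
have half : x / 2 <= x - 1 - 2 * m%:R.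
  have rl : 30 <= r * l by nra.
  have : 10 * (r * l) <= x by rewrite xE; nra.
  lra.
have gapE : (2 * m < n.-1)%N.
  rewrite -(ltr_nat R) -subn1 natrB // natrM -subr_gt0.
  by apply: lt_le_trans half; rewrite divr_gt0.
have u : 'I_n by exact: Ordinal n_pos.
apply: (@breaker_wins R n b u) => //.
  by rewrite -(ltr_nat R); apply: lt_le_trans b_ge; nra.
rewrite -/m.
have ln_ge : l - 1 <= ln ((n.-1 - 2 * m)%:R : R).
  rewrite natrB ?(ltnW gapE) // -subn1 natrB // natrM.
  apply: (@le_trans _ _ (ln (x / 2))).
    rewrite ln_div ?posrE // lerD2l lerN2.
    have -> : 2 = 1 + 1 :> R by [].
    by rewrite le_ln1Dx //; lra.
  by rewrite ler_ln ?posrE ?divr_gt0 // (lt_le_trans _ half) ?divr_gt0.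
apply: (@le_trans _ _ ((a * r / 2) * (l - 3))); last first.
  apply: ler_pM; [by nra | by lra | by lra | by lra].
apply: (le_trans m_le).
have key : 1 <= l * del - 3 * a / 2.
  by move: l_del; rewrite ler_pdivrMr //; lra.
have : 2 <= r * (l * del - 3 * a / 2) by nra.
have -> : 2 * r * l / a = r * l * (2 / a) by field; rewrite gt_eqF.
rewrite /del; set y := 2 / a; nra.
Qed.

Theorem theorem3 (R : realType) :
  (exists n0 : nat, forall n : nat, (n0 <= n)%N ->
     has_winning_strategy R 2 2
       (Num.truncn (1 / 9 * ((n%:R : R) `^ (1 / 8) / (ln (n%:R : R)) `^ (3 / 8))))
       n Maker)
  /\
  (forall eps : R, 0 < eps ->
     exists n1 : nat, forall n : nat, (n1 <= n)%N ->
       has_winning_strategy R 2 2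
         (Num.truncn ((2 + eps) * Num.sqrt ((n%:R : R) / ln (n%:R : R))))
         n Breaker).
Proof.
by split; [exact: maker_wins_eventually | exact: breaker_wins_eventually].
Qed.
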